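(* Let $k \ge 4$ and $\zeta \in \{k-3,k-2\}$. If $G$ is a $k$-$\gamma_c$-critical graph with exactly $\zeta$ cut-vertices, then $G$ is traceable.
   Context: Graphs are finite and simple. For a connected graph $G$, a connected dominating set is a set $S\subseteq V(G)$ such that every vertex outside $S$ has a neighbor in $S$ and $G[S]$ is connected; $\gamma_c(G)$ is the minimum size of such a set. A connected graph $G$ is $k$-$\gamma_c$-critical if $\gamma_c(G)=k$ and $\gamma_c(G+uv)<k$ for every pair of non-adjacent vertices $u,v$. A graph is traceable if it has a hamiltonian path (a path through all vertices). *)

(* Defs.v *)
From mathcomp Require Import all_boot.

Set Implicit Arguments.
Unset Strict Implicit.
Unset Printing Implicit Defensive.

(* A finite simple graph is a symmetric irreflexive adjacency relation on a
   finType; these two properties are hypotheses of the theorem and not part of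
   the definitions below. *)

Section Graph.

Variables (T : finType) (e : rel T).
Implicit Types (S : {set T}) (u v x y : T).

(* The edges of G[S], kept as a relation on the whole of T. *)
Definition induced S : rel T := [rel x y | [&& x \in S, y \in S & e x y]].

Definition connected_in S : bool :=
  (S != set0) && [forall x in S, forall y in S, connect (induced S) x y].

Definition connected_graph : bool := connected_in [set: T].

Definition dominating S : bool :=
  [forall x, (x \notin S) ==> [exists y in S, e x y]].

Definition connected_dominating S : bool := dominating S && connected_in S.

(* The default [set: T] is itself a connected dominating set when the graph is
   connected; gamma_c is meaningless on disconnected graphs. *)
Definition gamma_c : nat :=
  #|[arg min_(S < [set: T] | connected_dominating S) #|S|]|.

Definition add_edge u v : rel T :=
  [rel x y | [|| e x y, (x == u) && (y == v) | (x == v) && (y == u)]].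

Definition components_in S : nat := n_comp (induced S) S.

Definition cut_vertex v : bool :=
  components_in [set: T] < components_in [set~ v].

Definition traceable : Prop :=
  exists p : seq T, [/\ sorted e p, uniq p & forall x, x \in p].

End Graph.

Definition gamma_c_critical (T : finType) (k : nat) (e : rel T) : Prop :=
  [/\ connected_graph e, gamma_c e = k &
      forall u v : T, u != v -> ~~ e u v -> gamma_c (add_edge e u v) < k].

Lemma gamma_cP (T : finType) (e : rel T) : connected_graph e ->
  (exists2 S, connected_dominating e S & #|S| = gamma_c e) /\
  (forall S, connected_dominating e S -> gamma_c e <= #|S|).
Proof.
move=> conn; have domT : connected_dominating e [set: T].
  by apply/andP; split=> //; apply/forallP=> x; rewrite inE.
rewrite /gamma_c; case: arg_minnP => // S domS minS.
by split=> //; exists S.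
Qed.

(* Main.v *)
Require Import Defs.
From mathcomp Require Import all_boot.
From mathcomp Require Import zify.

Set Implicit Arguments.
Unset Strict Implicit.
Unset Printing Implicit Defensive.

(* A minimum connected dominating set [D] contains all cut vertices and at most three further
   vertices. Call a side of a cut vertex an end if it contains no cut vertex. Of two disjoint ends
   at most one meets [D] in fewer than two vertices, so there are exactly two ends, the blocks form
   a chain, and every block between the ends contains at most one vertex of [D] that is not a cut
   vertex. By criticality such a block is complete once its two cut vertices are removed, hence has
   a hamiltonian path between them.

   It remains to find, in an end block with cut vertex [v] meeting [D] in at most three vertices
   besides [v], a hamiltonian path from [v]. There the set [A] of neighbours of [v] is a clique.
   Let [R] be the set of the remaining vertices. For non-adjacent [u, w] in [R], criticality gives
   [a] in [A] adjacent to [u], up to exchanging [u] and [w], such that [a] and [u] dominate all of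
   [R] except [w]. Cover [R] by as few paths as possible. Ends of distinct paths are not adjacent,
   so these vertices [a] are available as connectors, each adjacent to almost all ends. Ordering
   the paths along a hamiltonian path of the tournament of arrows [u -> w] gives enough distinct
   connectors to join all paths, and criticality at [v] and a non-neighbour of [v], or the
   minimality of the cover, provides one more vertex of [A] through which the path enters. *)

(** * Sequences *)

(** Blocks are not formalised: statements are about a side of a cut vertex [v], that is, a union of
    components of G - v. Every connected dominating set contains [v], and its traces on the two
    sides of [v] can be exchanged independently. Hence a witness of criticality for an edge added on
    one side has strictly fewer vertices there than any admissible trace. The constant three is k
    minus the least allowed number of cut vertices. In an end it leaves the witness at most two
    vertices besides [v], and connectedness makes one of them a neighbour of [v]; this is the origin
    of the pairs a, u. Three disjoint ends would hold at least 0 + 2 + 2 vertices of D, more than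
    three, and two ends hold at least two, which leaves one for everything between them. Most case
    distinctions serve to find it. *)

Section Seqs.
Variables (T : eqType) (e : rel T) (e_sym : symmetric e) (x0 : T).
Implicit Types (P Q : seq T).

Lemma sorted_cat P Q : P != [::] -> Q != [::] ->
  sorted e (P ++ Q) = [&& sorted e P, sorted e Q & e (last x0 P) (head x0 Q)].
Proof. by case: P Q => [|x P] [|y Q] //= _ _; rewrite cat_path /= andbCA andbC -andbA. Qed.

Lemma sorted_rev_sym P : sorted e (rev P) = sorted e P.
Proof.
rewrite rev_sorted; case: P => //= x P.
by apply: eq_path => a b /=; rewrite e_sym.
Qed.

Lemma head_cat P Q : P != [::] -> head x0 (P ++ Q) = head x0 P.
Proof. by case: P. Qed.

Lemma last_cat_ne P Q : Q != [::] -> last x0 (P ++ Q) = last x0 Q.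
Proof. by case: Q => // y Q _; rewrite last_cat. Qed.

Lemma last_mid P y Q : Q != [::] -> last x0 (P ++ y :: Q) = last x0 Q.
Proof. by case: Q => // z Q _; rewrite last_cat. Qed.

Lemma head_rev P : head x0 (rev P) = last x0 P.
Proof. by case/lastP: P => // P x; rewrite rev_rcons last_rcons. Qed.

Lemma last_rev P : last x0 (rev P) = head x0 P.
Proof. by case: P => // x P; rewrite rev_cons last_rcons. Qed.

Lemma rev_eq0 P : (rev P == [::]) = (P == [::]).
Proof. by rewrite -!size_eq0 size_rev. Qed.

Lemma head_mem P : P != [::] -> head x0 P \in P.
Proof. by case: P => // x P _; rewrite mem_head. Qed.

Lemma last_mem P : P != [::] -> last x0 P \in P.
Proof. by case: P => // x P _; rewrite /= mem_last. Qed.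

Lemma head_neq_last P : 1 < size P -> uniq P -> head x0 P != last x0 P.
Proof.
case: P => [|x [|y P]] //= _ /andP[xP _].
by apply: contra xP => /eqP->; apply: mem_last.
Qed.

End Seqs.

(** Redei's theorem. Sorting by a total relation relates consecutive elements even without
    transitivity; the reflexive closure makes [r] total, and [uniq] removes the equalities again. *)
Lemma tournament_path (U : eqType) (r : rel U) (s : seq U) : uniq s ->
  {in s &, forall x y, x != y -> r x y || r y x} ->
  exists2 s', perm_eq s' s & sorted r s'.
Proof.
move=> us tot; pose r' x y := (x == y) || r x y; exists (sort r' s); first by rewrite perm_sort.
have tot' : {in s &, total r'}.
  move=> x y xs ys; rewrite /r' eq_sym; have [->|/= ] := eqVneq y x; first by [].
  by rewrite eq_sym => xy; apply: tot.
have: sorted r' (sort r' s) by apply: (sort_sorted_in (P := [in s])) => //; apply/allP.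
have: uniq (sort r' s) by rewrite sort_uniq.
case: (sort r' s) => //= x t; elim: t x => //= y t IH x /andP[/norP[xy yt] ut] /andP[/orP[]].
  by rewrite (negPf xy).
by move=> -> /=; apply: IH.
Qed.

(** A permutation goal becomes a linear identity between the counts of an arbitrary predicate. *)
Ltac perm_count := rewrite /=; apply/permP => ?;
  do 4! rewrite ?(flatten_cat, count_cat, count_rev) /=; clear; lia.

(** * Hamiltonian paths leaving a clique *)

Section Hub.

Variables (T : finType) (e : rel T) (A R : {set T}).
Hypotheses (e_sym : symmetric e) (e_irr : irreflexive e).
Hypothesis (A_clique : {in A &, forall a b, a != b -> e a b}).
Hypothesis A_notin_R : forall x, x \in A -> x \notin R.

(* [A] and [R] stand for the neighbours and the non-neighbours of the cut vertex [v] in an end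
   block, and [link a u w] for the outcome of adding the edge [uw]: together with [v], the two
   vertices [a] and [u] dominate everything but [w]. *)
Definition link a u w :=
  [&& a \in A, e a u, ~~ e a w
    & [forall z in R, (z != w) ==> [|| z == u, e u z | e a z]]].

Definition arrow u w := [exists a, link a u w].

Hypothesis arrow_total :
  {in R &, forall u w, u != w -> ~~ e u w -> arrow u w || arrow w u}.

(* The outcome of adding the edge [vx]. *)
Hypothesis hub_dom : forall x z0, x \in R -> z0 \in R -> z0 != x ->
  (exists a d, [/\ [/\ a \in A, d \in A :|: R, ~~ e a x & ~~ e d x],
       d \in R -> e a d
     & {in R, forall z, z != x -> [|| z == d, e a z | e d z]}]) \/
  (exists2 d, d \in A :|: R & {in R, forall z, [|| z == x, z == d, e x z | e d z]}).

Hypothesis two_nbrs : forall x y, x \in R ->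
  exists z, [/\ z \in A :|: R, z != y & e x z].

Hypothesis hub_edge : R != set0 -> exists a r, [/\ a \in A, r \in R & e a r].

(** [ys] need not exhaust [A]: as [A] is a clique, the vertices that the path misses can be put in
    front of it. *)
Definition hub_path := exists a Z ys, [/\ a \in A, path e a Z,
  perm_eq (a :: Z) (ys ++ enum R), uniq ys & all [in A] ys].

(** * Path covers of [R] and the ends of their paths *)

Definition cover (ps : seq (seq T)) :=
  all (fun P => (P != [::]) && sorted e P) ps && perm_eq (flatten ps) (enum R).

Definition min_cover ps := cover ps /\ forall qs, cover qs -> size ps <= size qs.

Lemma cover_perm ps qs : perm_eq ps qs -> cover ps -> cover qs.
Proof.
move=> pq /andP[/allP c1 c2]; apply/andP; split.
  by apply/allP => P; rewrite -(perm_mem pq); apply: c1.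
by rewrite -(permPl (perm_flatten pq)).
Qed.

Lemma min_cover_perm ps qs : perm_eq ps qs -> min_cover ps -> min_cover qs.
Proof.
move=> pq [c m]; split; first exact: cover_perm c.
by rewrite -(perm_size pq).
Qed.

Lemma min_cover_size ps qs : min_cover ps -> cover qs -> size qs = size ps -> min_cover qs.
Proof. by move=> [_ m] c sz; split=> // rs; rewrite sz; apply: m. Qed.

Lemma cover_rev P ps : cover (P :: ps) -> cover (rev P :: ps).
Proof.
rewrite /cover /= rev_eq0 sorted_rev_sym // => /andP[-> /=].
by apply: perm_trans; rewrite perm_cat2r perm_rev.
Qed.

Lemma cover_uniq ps : cover ps -> uniq (flatten ps).
Proof. by case/andP=> _ /perm_uniq->; apply: enum_uniq. Qed.

Lemma cover_mem ps x : cover ps -> (x \in flatten ps) = (x \in R).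
Proof. by case/andP=> _ /perm_mem->; rewrite mem_enum. Qed.

Lemma cover_sub ps P x : cover ps -> P \in ps -> x \in P -> x \in R.
Proof. by move=> c Pps xP; rewrite -(cover_mem _ c); apply/flattenP; exists P. Qed.

Lemma cover_uniq_in ps P : cover ps -> P \in ps -> uniq P.
Proof.
move=> c /perm_to_rem pq; have := cover_uniq (cover_perm pq c).
by rewrite /= cat_uniq => /andP[].
Qed.

Lemma coverP ps P : cover ps -> P \in ps -> (P != [::]) /\ sorted e P.
Proof. by case/andP=> /allP c _ /c/andP. Qed.

Lemma min_cover_ne ps P Q : min_cover ps -> P \in ps -> Q \in ps -> P != Q ->
  exists rs, min_cover (P :: Q :: rs) /\ perm_eq ps (P :: Q :: rs).
Proof.
move=> m Pps Qps PQ; exists (rem Q (rem P ps)).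
have pq : perm_eq ps (P :: Q :: rem Q (rem P ps)).
  rewrite (permPl (perm_to_rem Pps)) perm_cons perm_to_rem //.
  have := Qps; rewrite (perm_mem (perm_to_rem Pps)) inE eq_sym.
  by rewrite (negPf PQ).
by split=> //; apply: min_cover_perm m.
Qed.

Lemma cover_uniq_ps ps : cover ps -> uniq ps.
Proof.
elim: ps => //= P ps IH c; have /= := cover_uniq c.
rewrite cat_uniq => /and3P[uP nh u].
have [nP sP] : (P != [::]) /\ sorted e P by apply: (coverP c); rewrite mem_head.
have ups : uniq ps.
  have [/= /andP[_ a] _] := andP c; elim: ps u a {IH c nh} => //= Q qs IHq.
  rewrite cat_uniq => /and3P[uQ nhQ uqs] /andP[/andP[nQ _] /(IHq uqs) ->].
  rewrite andbT; apply: contra nhQ => Qqs; apply/hasP.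
  case: Q nQ Qqs {uQ} => // x Q _ Qqs; exists x; last exact: mem_head.
  by apply/flattenP; exists (x :: Q) => //; rewrite mem_head.
rewrite ups andbT; apply: contra nh => Pps; apply/hasP.
case: P nP Pps {uP c sP} => // x P _ Pps; exists x; last exact: mem_head.
by apply/flattenP; exists (x :: P) => //; rewrite mem_head.
Qed.

Section Base.
Variable x0 : T.
Notation hd := (head x0).
Notation la := (last x0).

(** An edge here would allow the two paths to be concatenated, saving one. *)
Lemma min_nadj P Q ps : min_cover (P :: Q :: ps) -> ~~ e (la P) (hd Q).
Proof.
move=> [/andP[/= /and3P[/andP[nP sP] /andP[nQ sQ] al] c] m].
apply/negP => ePQ; have /m : cover ((P ++ Q) :: ps); last by rewrite ltnn.
rewrite /cover /= al (sorted_cat e x0) // sP sQ ePQ /= catA in c *.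
by rewrite andbT c andbT; case: P nP {sP ePQ c}.
Qed.

Lemma min_rev1 P ps : min_cover (P :: ps) -> min_cover (rev P :: ps).
Proof. by move=> [c m]; split; [apply: cover_rev | exact: m]. Qed.

Lemma min_swap P Q ps : min_cover (P :: Q :: ps) -> min_cover (Q :: P :: ps).
Proof. by apply: min_cover_perm; rewrite -cat1s -(cat1s Q ps) perm_catCA. Qed.

Lemma min_rev2 P Q ps : min_cover (P :: Q :: ps) -> min_cover (P :: rev Q :: ps).
Proof. by move/min_swap/min_rev1/min_swap. Qed.

Definition ends P := [:: hd P; la P].

Lemma ends_mem P x : P != [::] -> x \in ends P -> x \in P.
Proof. by move=> nP; rewrite !inE => /orP[] /eqP->; rewrite (head_mem, last_mem). Qed.

(** Reversing a path keeps a cover minimum, so every choice of ends reduces to [min_nadj]. *)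
Lemma ends_nadj ps P Q u w : min_cover ps -> P \in ps -> Q \in ps -> P != Q ->
  u \in ends P -> w \in ends Q -> ~~ e u w /\ u != w.
Proof.
move=> m Pps Qps PQ uP wQ; have [rs [m2 _]] := min_cover_ne m Pps Qps PQ.
split.
  move: uP wQ; rewrite !inE => /orP[]/eqP-> /orP[]/eqP->.
  - by rewrite -(last_rev x0 P); apply: min_nadj (min_rev1 m2).
  - by rewrite -(last_rev x0 P) -(head_rev x0 Q); apply: min_nadj (min_rev2 (min_rev1 m2)).
  - exact: min_nadj m2.
  - by rewrite -(head_rev x0 Q); apply: min_nadj (min_rev2 m2).
have [nP _] := coverP m.1 Pps; have [nQ _] := coverP m.1 Qps.
have := cover_uniq m2.1; rewrite /= cat_uniq => /and3P[_ /hasPn nh _].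
apply/eqP => uw; have /nh : u \in Q ++ flatten rs.
  by rewrite mem_cat uw ends_mem.
by rewrite /= ends_mem.
Qed.

Lemma hub_pathI ys ps a Z : cover ps -> a \in A -> path e a Z ->
  perm_eq (a :: Z) (ys ++ flatten ps) -> uniq ys -> all [in A] ys -> hub_path.
Proof.
move=> /andP[_ c] aA pZ pq uy ay; exists a, Z, ys; split=> //.
by rewrite (permPl pq) perm_cat2l.
Qed.

(** The form in which links are used: ends of other paths are not adjacent to [u], so [a] has to
    dominate all of them except [w]. *)
Lemma linkP a u w : link a u w ->
  [/\ a \in A, e a u, ~~ e a w &
      forall z, z \in R -> z != w -> ~~ e u z -> u != z -> e a z].
Proof.
case/and4P=> aA au aw /forall_inP dom; split=> // z zR zw uz nuz.
by have := implyP (dom z zR) zw; rewrite eq_sym (negPf nuz) (negPf uz).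
Qed.


Lemma hub_path_seq ys ps Z : cover ps -> sorted e Z -> hd Z \in A ->
  Z != [::] -> perm_eq Z (ys ++ flatten ps) -> uniq ys -> all [in A] ys -> hub_path.
Proof. by move=> c; case: Z => // a Z sZ aA _; apply: hub_pathI. Qed.

Lemma arrowP u w : reflect (exists a, link a u w) (arrow u w).
Proof. exact: existsP. Qed.

(** If the ends of [P] are adjacent, [P] closes to a cycle, which can be opened at a vertex with a
    neighbour in [A]. If they are distinct and not adjacent, the arrow between them gives one of
    them such a neighbour. *)
Lemma hub_path1 P : min_cover [:: P] -> hub_path.
Proof.
move=> m; have c := m.1.
have PP : P \in [:: P] by rewrite mem_head.
have [nP sP] := coverP c PP.
have PR x : x \in P -> x \in R by apply: cover_sub c _.
have enter a Q : a \in A -> perm_eq Q P -> sorted e Q -> e a (hd Q) -> hub_path.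
  move=> aA pQ sQ ea; apply: (@hub_path_seq [:: a] [:: P] (a :: Q)) => //=.
  - by case: Q sQ ea {pQ} => //= b Q -> ->.
  - by rewrite cats0 perm_cons.
  - by rewrite aA.
have [hl|hl] := boolP (hd P == la P).
  have [|a [r [aA rR ear]]] := hub_edge.
    by apply/set0Pn; exists (hd P); rewrite PR // head_mem.
  have := rR; rewrite -(cover_mem r c) /= cats0 => rP.
  have rE : r = hd P.
    case: P m c PP nP sP PR enter hl rP => [|x [|y P]] //=.
      by move=> _ _ _ _ _ _ _ _; rewrite inE => /eqP.
    move=> m c _ _ _ _ _ /eqP xE; have := cover_uniq c; rewrite /= cats0.
    by rewrite {1}xE mem_last.
  by apply: (enter a P); rewrite // -rE.
have [ehl|nehl] := boolP (e (hd P) (la P)).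
  have [|a [r [aA rR ear]]] := hub_edge.
    by apply/set0Pn; exists (hd P); rewrite PR // head_mem.
  have := rR; rewrite -(cover_mem r c) /= cats0 => /splitPr rP.
  case: rP m c PP nP sP PR enter hl ehl => L M _ _ _ _ sP _ enter _ ehl.
  apply: (enter a (r :: M ++ L)) => //; first by perm_count.
  case: L sP ehl enter => [|x L] sP ehl _; first by rewrite cats0.
  move: sP ehl; rewrite -cat_cons !(sorted_cat e x0) // last_cat_ne //= => /and3P[-> -> _].
  by rewrite e_sym.
have hR : hd P \in R by rewrite PR // head_mem.
have lR : la P \in R by rewrite PR // last_mem.
have /orP[/arrowP[a /linkP[aA ea _ _]]|/arrowP[a /linkP[aA ea _ _]]] :=
    arrow_total hR lR hl nehl.
  exact: (enter a P).
apply: (enter a (rev P)); rewrite ?perm_rev ?sorted_rev_sym //.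
by rewrite head_rev.
Qed.

(* The arrow gives [y] joining [hd P] to [la Q]; as [y] is adjacent to both, the arrow between
   [hd P] and [la Q] provides a second vertex of [A], through which the path enters. *)
Lemma two_paths_long P Q : min_cover [:: P; Q] -> 1 < size Q ->
  arrow (hd P) (hd Q) -> hub_path.
Proof.
move=> m szQ /arrowP[y ly]; have [yA yP yQ yd] := linkP ly; have c := m.1.
have Pin : P \in [:: P; Q] by rewrite mem_head.
have Qin : Q \in [:: P; Q] by rewrite !inE eqxx orbT.
have [nP sP] := coverP c Pin; have [nQ sQ] := coverP c Qin.
have PQ : P != Q by have := cover_uniq_ps c; rewrite /= inE andbT.
have PR x : x \in P -> x \in R by apply: cover_sub c _.
have QR x : x \in Q -> x \in R by apply: cover_sub c _.
have uPQ := cover_uniq c; rewrite /= cats0 cat_uniq in uPQ.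
have /and3P[uP _ uQ] := uPQ.
have hlQ : hd Q != la Q by apply: head_neq_last.
have nad u w : u \in ends P -> w \in ends Q -> ~~ e u w /\ u != w.
  exact: ends_nadj m Pin Qin PQ.
have hP : hd P \in ends P by rewrite mem_head.
have lP : la P \in ends P by rewrite !inE eqxx orbT.
have hQ : hd Q \in ends Q by rewrite mem_head.
have lQ : la Q \in ends Q by rewrite !inE eqxx orbT.
have hPR : hd P \in R by rewrite PR // head_mem.
have lPR : la P \in R by rewrite PR // last_mem.
have lQR : la Q \in R by rewrite QR // last_mem.
have yl : e y (la Q).
  by have [n1 n2] := nad _ _ hP lQ; apply: yd; rewrite // eq_sym.
have [n1 n2] := nad _ _ hP lQ.
have /orP[/arrowP[z /linkP[zA z1 z2 zd]]|/arrowP[z /linkP[zA z1 z2 zd]]] :=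
    arrow_total hPR lQR n2 n1.
  have zQ : e z (hd Q) by have [? ?] := nad _ _ hP hQ; apply: zd; rewrite ?QR ?head_mem.
  have yz : z != y by apply: contraNneq z2 => ->.
  apply: (@hub_path_seq [:: z; y] [:: P; Q] (z :: Q ++ y :: P)) => //=.
  - rewrite (cat_path e z Q); case: (Q) nQ sQ zQ yl => //= b Q' _ -> -> /=.
    by case: (P) nP sP yP => //= b' P' _ -> ->; rewrite e_sym => ->.
  - by perm_count.
  - by rewrite inE yz.
  - by rewrite zA yA.
have yz : y != z by apply: contraNneq z2 => <-.
have [szP|szP] := ltnP 1 (size P).
  have hlP : hd P != la P by apply: head_neq_last.
  have zP : e z (la P).
    have [? ?] := nad _ _ lP lQ; apply: zd; rewrite // 1?eq_sym // 1?e_sym //.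
  apply: (@hub_path_seq [:: z; y] [:: P; Q] ([:: z] ++ rev P ++ [:: y] ++ rev Q)) => //.
  - rewrite !(sorted_cat e x0) ?rev_eq0 ?head_cat ?rev_eq0 //=; last by case: rev.
    by rewrite !sorted_rev_sym // !head_rev last_rev sP sQ yl zP e_sym yP.
  - by perm_count.
  - by rewrite /= inE eq_sym yz.
  - by rewrite /= zA yA.
case: P m c Pin Qin nP sP PQ PR uPQ uP nad hP lP hPR lPR n1 n2 yP szP ly yd z2 zd => [|x [|//]] //= m c.
move=> Pin Qin _ _ PQ PR uPQ _ nad xP _ xR _ n1 n2 yP _ ly yd z2 zd.
(* [P] is the single vertex [x], which [z] misses, so [x] is passed through between [y] and a second
   neighbour [t]. *)
have [t [tAR ty xt]] := two_nbrs y xR.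
have [tA|tnA] := boolP (t \in A).
  apply: (@hub_path_seq [:: t; y] [:: [:: x]; Q] ([:: t; x; y] ++ rev Q)) => //.
  - rewrite (sorted_cat e x0) ?rev_eq0 //=.
    by rewrite sorted_rev_sym // head_rev sQ yl e_sym xt e_sym yP.
  - by perm_count.
  - by rewrite /= inE ty.
  - by rewrite /= tA yA.
have tR : t \in R by move: tAR; rewrite inE (negPf tnA).
have tQ : t \in Q.
  move: tR; rewrite -(cover_mem t c) /= cats0 inE => /orP[/eqP tx|//].
  by rewrite tx e_irr in xt.
case/splitPr: tQ m c PQ QR uPQ uQ nad lQR n1 n2 szQ ly yl z1 zd nQ sQ hlQ hQ lQ => L M.
have [->|nL] := eqVneq L [::].
  move=> _ _ _ _ _ _ nad _ _ _ _ _ _ _ _ _ _ _ hQ _.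
  by have [] := nad _ _ xP hQ; rewrite /= xt.
have [->|nM] := eqVneq M [::].
  move=> _ _ _ _ _ _ nad _ _ _ _ _ _ _ _ _ _ _ _ lQ.
  by have [] := nad _ _ xP lQ; rewrite /= last_cat /= xt.
rewrite !last_mid // => m c _ QR uPQ uQ nad lQR n1 n2 _ ly yl z1 zd _ sQ _ _ _.
have [sL sM Lt tM] : [/\ sorted e L, sorted e M, e (la L) t & e t (hd M)].
  move: sQ; rewrite (sorted_cat e x0) //= => /and3P[-> + ->].
  by case: (M) nM => //= b M' _ /andP[-> ->].
(* Moving [x] in front of [t :: M] gives another minimum cover, in which [la L] and [la M] are ends
   of distinct paths; hence [z] has to dominate [la L]. *)
have c2 : cover [:: L; [:: x; t] ++ M].
  have [_ pR] := andP c.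
  rewrite /cover /= nL sL xt -(permPr pR) /=; apply/andP; split; last by perm_count.
  by case: (M) nM sM tM => //= b M' _ -> ->.
have m2 := min_cover_size m c2 erefl.
have nLM : ~~ e (la L) (la M).
  have := min_nadj (min_rev2 m2); rewrite head_rev last_cat_ne //.
have lLR : la L \in R by rewrite QR // mem_cat last_mem.
have zL : e z (la L).
  apply: zd => //.
  - have := cover_uniq c; rewrite /= cats0 => /andP[+ _]; apply: contraNneq => <-.
    by rewrite mem_cat last_mem.
  - by rewrite e_sym.
  - move: uQ; rewrite cat_uniq => /and3P[_ /hasPn nh _]; apply/eqP => lE.
    have /nh : la M \in t :: M by rewrite inE last_mem ?orbT.
    by rewrite lE /= last_mem.
apply: (@hub_path_seq [:: y; z] [:: [:: x]; L ++ t :: M]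
          ([:: y; x; t] ++ M ++ [:: z] ++ rev L)) => //.
- rewrite !(sorted_cat e x0) ?rev_eq0 ?head_cat //=; last by case: (M).
  by rewrite yP xt sM sorted_rev_sym // sL head_rev zL tM e_sym z1.
- by perm_count.
- by rewrite /= inE yz.
- by rewrite /= zA yA.
Qed.

Lemma two_paths_long2 P Q : min_cover [:: P; Q] -> 1 < size P -> 1 < size Q -> hub_path.
Proof.
move=> m sP sQ.
have Pin : P \in [:: P; Q] by rewrite mem_head.
have Qin : Q \in [:: P; Q] by rewrite !inE eqxx orbT.
have [nP _] := coverP m.1 Pin; have [nQ _] := coverP m.1 Qin.
have PQ : P != Q by have := cover_uniq_ps m.1; rewrite /= inE andbT.
have [n1 n2] := @ends_nadj _ _ _ (hd P) (hd Q) m Pin Qin PQ (mem_head _ _) (mem_head _ _).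
have hP : hd P \in R by apply: (cover_sub m.1 Pin); rewrite head_mem.
have hQ : hd Q \in R by apply: (cover_sub m.1 Qin); rewrite head_mem.
case/orP: (arrow_total hP hQ n2 n1); first exact: two_paths_long.
by apply: two_paths_long => //; apply: min_swap.
Qed.

(** The case left is [Q = [:: x]]. A neighbour [t] of [x] in [R] splits [P], and rearranging the
    pieces around [t] gives either two long paths or further non-adjacent ends. Without such a
    neighbour, two neighbours of [x] in [A] enclose it. *)
Lemma hub_path2 P Q : min_cover [:: P; Q] -> hub_path.
Proof.
wlog : P Q / arrow (hd P) (hd Q).
  move=> wl m.
  have Pin : P \in [:: P; Q] by rewrite mem_head.
  have Qin : Q \in [:: P; Q] by rewrite !inE eqxx orbT.
  have [nP _] := coverP m.1 Pin; have [nQ _] := coverP m.1 Qin.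
  have PQ : P != Q by have := cover_uniq_ps m.1; rewrite /= inE andbT.
  have [n1 n2] := @ends_nadj _ _ _ (hd P) (hd Q) m Pin Qin PQ (mem_head _ _) (mem_head _ _).
  have hP : hd P \in R by apply: (cover_sub m.1 Pin); rewrite head_mem.
  have hQ : hd Q \in R by apply: (cover_sub m.1 Qin); rewrite head_mem.
  by case/orP: (arrow_total hP hQ n2 n1) => ar; [apply: (wl P Q) | apply: (wl Q P) => //; apply: min_swap].
move=> aPQ m; have [szQ|szQ] := ltnP 1 (size Q); first exact: two_paths_long aPQ.
have c := m.1.
have Pin : P \in [:: P; Q] by rewrite mem_head.
have Qin : Q \in [:: P; Q] by rewrite !inE eqxx orbT.
have [nP sP] := coverP c Pin; have [nQ sQ] := coverP c Qin.
have PQ : P != Q by have := cover_uniq_ps c; rewrite /= inE andbT.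
have PR x : x \in P -> x \in R by apply: cover_sub c _.
case: Q szQ aPQ m c Pin Qin nQ sQ PQ => [|x [|//]] //= _ aPx m c Pin Qin _ _ Px.
have xR : x \in R by apply: (cover_sub c Qin); rewrite mem_head.
have nad u : u \in ends P -> ~~ e u x /\ u != x.
  by move=> uP; apply: (ends_nadj m Pin Qin Px); rewrite //= mem_head.
have hP : hd P \in ends P by rewrite mem_head.
have lP : la P \in ends P by rewrite !inE eqxx orbT.
have hPR : hd P \in R by rewrite PR // head_mem.
have lPR : la P \in R by rewrite PR // last_mem.
have [/exists_inP[t tR xt]|noR] := boolP [exists t in R, e x t].
  have tP : t \in P.
    move: tR; rewrite -(cover_mem t c) /= mem_cat inE => /orP[//|/eqP tx].
    by rewrite tx e_irr in xt.
  case/splitPr: tP m c PR nP sP nad hP lP hPR lPR aPx {Pin Qin Px} => L M.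
  have [->|nL] := eqVneq L [::].
    by move=> _ _ _ _ _ nad hP _ _ _; have [] := nad _ hP; rewrite /= e_sym xt.
  have [->|nM] := eqVneq M [::].
    by move=> _ _ _ _ _ nad _ lP _ _; have [] := nad _ lP; rewrite /= last_cat /= e_sym xt.
  rewrite head_cat // !last_mid // => m c PR _ sP nad hP lP hPR lPR aPx.
  have [sL sM Lt tM] : [/\ sorted e L, sorted e M, e (la L) t & e t (hd M)].
    move: sP; rewrite (sorted_cat e x0) //= => /and3P[-> + ->].
    by case: (M) nM => //= b M' _ /andP[-> ->].
  have szL : 0 < size L by case: (L) nL.
  have szM : 0 < size M by case: (M) nM.
  have [_ pR] := andP c.
  have tx : e t x by rewrite e_sym.
  have [eLM|nLM] := boolP (e (la L) (hd M)).
    apply: (@two_paths_long2 (L ++ M) [:: t; x]) => //; last by rewrite size_cat (leq_add szL szM).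
    apply: (min_cover_size m) => //.
    rewrite /cover /= (sorted_cat e x0) //= tx sL sM eLM -(permPr pR) !andbT.
    by apply/andP; split=> //; [case: (L) nL | perm_count].
  have mL : min_cover [:: L; [:: x; t] ++ M].
    apply: (min_cover_size m) => //.
    rewrite /cover /= xt sL nL -(permPr pR) /=; apply/andP; split; last by perm_count.
    by case: (M) nM sM tM => //= b M' _ -> ->.
  have mM : min_cover [:: L ++ [:: t; x]; M].
    apply: (min_cover_size m) => //.
    rewrite /cover /= (sorted_cat e x0) //= sL sM nM tx Lt -(permPr pR) /= !andbT.
    by apply/andP; split; [case: (L) nL | perm_count].
  have nLx : ~~ e (la L) x by have := min_nadj mL.
  have nxM : ~~ e x (hd M) by have := min_nadj mM; rewrite last_cat_ne.
  have nLlM : ~~ e (la L) (la M).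
    by have := min_nadj (min_rev2 mL); rewrite head_rev last_cat_ne.
  have [lLR hMR] : la L \in R /\ hd M \in R.
    by rewrite !PR // mem_cat ?inE ?last_mem ?head_mem ?orbT.
  have u0 := cover_uniq c; rewrite /= cat_uniq in u0.
  have /and3P[uP /hasPn ux _] := u0.
  have xP : x \notin L ++ t :: M by apply: ux; rewrite mem_head.
  have [lLx hMx] : la L != x /\ hd M != x.
    split; [apply: contraNneq xP => <- | apply: contraNneq xP => <-];
    by rewrite mem_cat ?inE ?last_mem ?head_mem ?orbT.
  have nLM2 z : z \in M -> la L != z.
    move=> zM; move: uP; rewrite cat_uniq => /and3P[_ /hasPn nh _]; apply/eqP => lE.
    by have /nh : z \in t :: M; rewrite ?inE ?zM ?orbT // -lE /= last_mem.
  (* Neither [la L] nor [hd M] is adjacent to [x], so the arrow between them has, in either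
     direction, a connector adjacent to [x]. *)
  have [w [wA wx]] : exists w, w \in A /\ e w x.
    case/orP: (arrow_total lLR hMR (nLM2 _ (head_mem _ nM)) nLM) => /arrowP[w /linkP[wA _ _ wd]];
    by exists w; split=> //; apply: wd; rewrite // 1?eq_sym // e_sym.
  case/orP: (arrow_total lPR xR (nad _ lP).2 (nad _ lP).1) => ar; last first.
    apply: (@two_paths_long [:: x] (rev (L ++ t :: M))).
    - by apply: min_rev2; apply: min_swap.
    - by rewrite size_rev size_cat /= addnS ltnS addn_gt0 szL.
    - by rewrite head_rev last_mid.
  have [y /linkP[yA yM yx yd]] := arrowP _ _ ar.
  have yL : e y (la L) by apply: yd; rewrite 1?e_sym 1?[_ == la L]eq_sym // nLM2 // last_mem.
  have wy : w != y by apply: contraNneq yx => <-.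
  apply: (@hub_path_seq [:: w; y] [:: L ++ t :: M; [:: x]]
            ([:: w; x; t] ++ M ++ [:: y] ++ rev L)) => //.
  - rewrite !(sorted_cat e x0) ?rev_eq0 ?head_cat //=; last by case: (M).
    by rewrite wx xt sM sorted_rev_sym // sL head_rev yL tM e_sym yM.
  - by perm_count.
  - by rewrite /= inE wy.
  - by rewrite /= wA yA.
have [y /linkP[yA yP yx _]] := arrowP _ _ aPx.
have xA z : z \in A :|: R -> e x z -> z \in A.
  by rewrite inE => /orP[//|zR] xz; case/exists_inP: noR; exists z.
have [t1 [t1AR _ xt1]] := two_nbrs x xR.
have [t2 [t2AR t21 xt2]] := two_nbrs t1 xR.
have [t1A t2A] := (xA _ t1AR xt1, xA _ t2AR xt2).
have ne t : e x t -> t != y by move=> xt; apply: contraNneq yx => <-; rewrite e_sym.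
apply: (@hub_path_seq [:: t1; t2; y] [:: P; [:: x]] ([:: t1; x; t2; y] ++ P)) => //.
- rewrite (sorted_cat e x0) //= sP e_sym xt1 xt2 yP A_clique //; exact: ne.
- by perm_count.
- by rewrite /= !inE negb_or eq_sym t21 !ne.
- by rewrite /= t1A t2A yA.
Qed.

(** * Connectors along a path of arrows *)

Definition linker u w := odflt x0 [pick a | link a u w].

Lemma linkerP u w : arrow u w -> link (linker u w) u w.
Proof. by rewrite /linker; case: pickP => //= no /existsP[a]; rewrite no. Qed.

Lemma links_mem (us : seq T) u y : path arrow u us -> y \in pairmap linker u us ->
  exists p q, [/\ p \in belast u us, q \in us & link y p q].
Proof.
elim: us u => //= w us IH u /andP[uw pw]; rewrite inE => /predU1P[->|/(IH _ pw)].
  by exists u, w; rewrite !mem_head; split=> //; apply: linkerP.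
by case=> p [q [pin qin l]]; exists p, q; rewrite !inE pin qin !orbT.
Qed.

(** Among pairwise non-adjacent vertices a connector misses exactly the target of its arrow, and the
    targets along the path are distinct. *)
Lemma links_uniq (us : seq T) u : path arrow u us -> uniq (u :: us) ->
  {subset u :: us <= R} -> {in u :: us &, forall x y, x != y -> ~~ e x y} ->
  uniq (pairmap linker u us).
Proof.
elim: us u => //= w us IH u /andP[uw pw] /and3P[/norP[nuw uus] wus u_us] sR ind.
apply/andP; split; last first.
  apply: IH => //=; first by rewrite wus.
    by move=> z zin; apply: sR; rewrite inE zin orbT.
  by move=> x y xin yin; apply: ind; rewrite inE ?xin ?yin orbT.
apply/negP => /(links_mem pw)[p [q [_ qus /linkP[_ _ nyq _]]]].
have [_ _ _ yd] := linkP (linkerP uw).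
case/negP: nyq; apply: yd; first by rewrite sR // !inE qus !orbT.
- by apply: contraNneq wus => <-.
- by apply: ind; rewrite ?inE ?eqxx ?qus ?orbT //; apply: contraNneq uus => ->.
- by apply: contraNneq uus => ->.
Qed.

Lemma links_A (us : seq T) u : path arrow u us -> all [in A] (pairmap linker u us).
Proof. by move=> pu; apply/allP => y /(links_mem pu)[p [q [_ _ /linkP[]]]]. Qed.

Lemma indep_links (I : seq T) : uniq I -> {subset I <= R} ->
  {in I &, forall x y, x != y -> ~~ e x y} ->
  exists ys, [/\ uniq ys, all [in A] ys, size ys = (size I).-1 &
    forall y, y \in ys -> exists v, forall z, z \in I -> z != v -> e y z].
Proof.
move=> uI sI ind.
have [] := @tournament_path _ arrow I uI.
  by move=> x y xI yI xy; apply: arrow_total; rewrite ?sI ?ind.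
case=> [|u us] pI sorI.
  by exists [::]; rewrite -(perm_size pI).
have sR : {subset u :: us <= R} by move=> z; rewrite (perm_mem pI); apply: sI.
have ind' : {in u :: us &, forall x y, x != y -> ~~ e x y}.
  by move=> x y; rewrite !(perm_mem pI); apply: ind.
exists (pairmap linker u us); split.
- by apply: links_uniq; rewrite // (perm_uniq pI).
- exact: links_A.
- by rewrite size_pairmap -(perm_size pI).
move=> y /(links_mem sorI)[p [q [pin qin /linkP[_ yp _ yd]]]]; exists q => z.
have pin' : p \in u :: us by apply: mem_belast.
rewrite -(perm_mem pI) => zI zq; have [->//|zp] := eqVneq z p.
by apply: yd; rewrite ?sR // ?ind' // eq_sym.
Qed.

(* For paths [P1, ..., Pp] sorted along arrows between their heads, with connectors [y1, ...],
   [chain P1 [:: P2; ...; Pp]] is [y1 P1 y2 P2 ... P(p-1)]; it leaves out [Pp], which can be put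
   in front of it in either direction. *)
Fixpoint chain P ps :=
  if ps is Q :: ps' then linker (hd P) (hd Q) :: P ++ chain Q ps' else [::].

Local Notation harrow := (fun P Q => arrow (hd P) (hd Q)).
Local Notation hlinks P ps := (pairmap linker (hd P) [seq hd Q | Q <- ps]).

Lemma hlinks_mem P ps y : path harrow P ps -> y \in hlinks P ps ->
  exists U V, [/\ U \in belast P ps, V \in ps & link y (hd U) (hd V)].
Proof.
elim: ps P => //= Q ps IH P /andP[PQ pQ]; rewrite inE => /predU1P[->|/(IH _ pQ)].
  by exists P, Q; rewrite !mem_head; split=> //; apply: linkerP.
by case=> U [V [Uin Vin l]]; exists U, V; rewrite !inE Uin Vin !orbT.
Qed.

Lemma chain_perm P ps Q :
  perm_eq (chain P (rcons ps Q)) (hlinks P (rcons ps Q) ++ flatten (P :: ps)).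
Proof.
elim: ps P => [|P' ps IH] P /=; first by rewrite perm_cons.
rewrite perm_cons; apply: (perm_trans (y := P ++ hlinks P' (rcons ps Q) ++ flatten (P' :: ps))).
  by rewrite perm_cat2l; apply: IH.
by rewrite perm_catCA.
Qed.

Lemma chain_last P ps Q z : all (fun P => P != [::]) (P :: ps) ->
  last z (chain P (rcons ps Q)) = la (last P ps).
Proof.
elim: ps P z => [|P' ps IH] P z /= /andP[nP].
  by rewrite cats0; case: P nP.
by move=> a; rewrite last_cat IH.
Qed.

(** The connector standing between [P] and [Q] belongs to the arrow from [Q] to its successor: it
    reaches [hd Q] as the source, and [la P] because this is an end of a third path. *)
Lemma chain_path cs P ps z : min_cover cs -> {subset P :: ps <= cs} -> uniq (P :: ps) ->
  path harrow P ps -> (forall Q ps', ps = Q :: ps' -> e z (linker (hd P) (hd Q))) ->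
  path e z (chain P ps).
Proof.
move=> m; elim: ps P z => //= Q ps IH P z sub /andP[nP uQ] /andP[PQ pQ] ez.
have Pcs : P \in cs by rewrite sub ?mem_head.
have [neP sP] := coverP m.1 Pcs.
have [_ yP _ _] := linkP (linkerP PQ).
rewrite (ez _ _ erefl) /= cat_path; apply/andP; split.
  by case: (P) neP sP yP => //= b P' _ -> ->.
apply: IH => //; first by move=> W Win; apply: sub; rewrite inE Win orbT.
move=> W ps' psE; rewrite psE in sub pQ nP uQ.
have [_ _ _ yd] := linkP (linkerP (andP pQ).1).
have [PQn PWn] : P != Q /\ P != W.
  by move: nP; rewrite !inE !negb_or => /and3P[].
have Qcs : Q \in cs by rewrite sub // !inE eqxx orbT.
have Wcs : W \in cs by rewrite sub // !inE eqxx !orbT.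
have -> : last (linker (hd P) (hd Q)) P = la P by case: (P) neP.
have lP : la P \in ends P by rewrite !inE eqxx orbT.
have [n1 n2] := ends_nadj m Pcs Qcs PQn lP (mem_head _ _).
have [n3 n4] := ends_nadj m Pcs Wcs PWn lP (mem_head _ _).
rewrite e_sym; apply: yd; rewrite // 1?e_sym 1?eq_sym //.
by apply: (cover_sub m.1 Pcs); rewrite last_mem.
Qed.

(** * Joining three or more paths *)

Section Spine.

Variables (P : seq T) (ps : seq (seq T)) (G Q : seq T).
Notation cs := (P :: rcons (rcons ps G) Q).
Notation ys := (hlinks P (rcons (rcons ps G) Q)).
Hypotheses (mcs : min_cover cs) (ar : path harrow P (rcons (rcons ps G) Q)).

Lemma spine_uniq : uniq cs.
Proof. exact: cover_uniq_ps mcs.1. Qed.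

(** Besides its target [hd V], a connector can miss only the far end of its source [U], which may be
    adjacent to [hd U]. *)
Lemma spine_adj y : y \in ys -> exists U V, [/\ U \in P :: rcons ps G,
  V \in rcons (rcons ps G) Q, y \in A, ~~ e y (hd V) & forall W z, W \in cs -> z \in ends W -> z != hd V ->
    (W != U) || (z == hd U) -> e y z].
Proof.
move=> /(hlinks_mem ar)[U [V [Uin Vin l]]]; have [yA yU yV yd] := linkP l.
exists U, V; split=> //; first by rewrite belast_rcons in Uin.
move=> W z Win zW zV /orP[WU|/eqP->//].
have Ucs : U \in cs by apply: mem_belast.
have UW : U != W by rewrite eq_sym.
have [n1 n2] := ends_nadj mcs Ucs Win UW (mem_head _ _) zW.
have [nW _] := coverP mcs.1 Win.
by apply: yd => //; apply: (cover_sub mcs.1 Win); apply: ends_mem.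
Qed.

Lemma heads_inj : {in cs &, injective hd}.
Proof.
move=> U W Uin Win hE; apply/eqP/negPn/negP => UW.
by have [_] := ends_nadj mcs Uin Win UW (mem_head _ _) (mem_head _ _); rewrite hE eqxx.
Qed.

Lemma head_R W : W \in cs -> hd W \in R.
Proof.
by move=> Win; apply: (cover_sub mcs.1 Win); apply: head_mem; case: (coverP mcs.1 Win).
Qed.

Lemma spine_ys_uniq : uniq ys.
Proof.
apply: links_uniq.
- by rewrite path_map.
- by rewrite -map_cons map_inj_in_uniq; [exact: spine_uniq | exact: heads_inj].
- by rewrite -map_cons => z /mapP[W Win ->]; apply: head_R.
rewrite -map_cons => x y /mapP[U Uin ->] /mapP[W Win ->] UW.
have {}UW : U != W by apply: contraNneq UW => ->.
exact: (ends_nadj mcs Uin Win UW (mem_head _ _) (mem_head _ _)).1.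
Qed.

Lemma spine_ys_A : all [in A] ys.
Proof. by apply/allP => y /spine_adj[U [V []]]. Qed.

Lemma in_spine W : (W \in cs) = [|| W == P, W \in ps, W == G | W == Q].
Proof. rewrite inE mem_rcons inE mem_rcons inE.
by case: (W == P); case: (W == G); case: (W == Q); case: (W \in ps). Qed.

Lemma Pcs : P \in cs. Proof. by rewrite in_spine eqxx. Qed.
Lemma Gcs : G \in cs. Proof. by rewrite in_spine eqxx !orbT. Qed.
Lemma Qcs : Q \in cs. Proof. by rewrite in_spine eqxx !orbT. Qed.

Lemma spine_neq : [/\ P \notin ps, P != G, P != Q & G != Q].
Proof.
have := spine_uniq; rewrite cons_uniq !rcons_uniq !(mem_rcons, inE).
rewrite !negb_or => /andP[/and3P[-> -> ->] /andP[/andP[QG _] _]].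
by rewrite eq_sym.
Qed.

Lemma spine_sorted F : perm_eq F Q -> sorted e F -> la F \in ends Q ->
  sorted e (F ++ chain P (rcons (rcons ps G) Q)).
Proof.
move=> FQ sF lF; have [nQ _] := coverP mcs.1 Qcs.
have [_ PG PQ GQ] := spine_neq.
case: F FQ sF lF => [|x F] FQ sF lF.
  by move: FQ; rewrite perm_sym => /perm_nilP Q0; rewrite Q0 in nQ.
rewrite /= cat_path; move: (sF) => /= -> /=.
apply: (chain_path mcs) => //; first exact: spine_uniq.
(* [W] is the second path and, as [G] precedes [Q], not the last; so [la F] is an end of a third
   path, and the connector from [P] to [W] reaches it. *)
move=> W ps' psE.
have Win : W \in rcons ps G.
  by case: (ps) psE => [|? ?] [<- _]; rewrite mem_head.
have WQ : W != Q.
  apply: contraTneq spine_uniq => <-; rewrite /= rcons_uniq Win andbF //.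
have Wcs : W \in cs.
  by rewrite inE mem_rcons inE Win !orbT.
have PW : P != W.
  apply: contraTneq spine_uniq => ->; rewrite /= mem_rcons inE Win orbT //.
have PWar : arrow (hd P) (hd W) by move: ar; rewrite psE => /andP[].
have [_ _ _ yd] := linkP (linkerP PWar).
have [n1 n2] := ends_nadj mcs Pcs Qcs PQ (mem_head _ _) lF.
have [n3 n4] := ends_nadj mcs Wcs Qcs WQ (mem_head _ _) lF.
rewrite e_sym; apply: yd; rewrite // 1?eq_sym //.
by apply: (cover_sub mcs.1 Qcs); apply: ends_mem.
Qed.

(* All connectors are used up by the spine: a further vertex of [A] is needed to enter it. *)
Lemma spine_enter1 F a : perm_eq F Q -> sorted e F -> la F \in ends Q ->
  a \in A -> a \notin ys -> e a (hd F) -> hub_path.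
Proof.
move=> FQ sF lF aA ays aF.
have := spine_sorted FQ sF lF.
have [nQ _] := coverP mcs.1 Qcs.
have nF : F != [::] by rewrite -size_eq0 (perm_size FQ) size_eq0.
set C := chain _ _ => sFC.
apply: (@hub_pathI (a :: ys) cs a (F ++ C)) => //; first exact: mcs.1.
- by case: (F) nF sFC aF => //= b F' _ -> ->.
- rewrite /= perm_cons (permPl (perm_cat FQ (chain_perm _ _ _))).
  by rewrite -!cats1 !flatten_cat /=; perm_count.
- by rewrite /= ays spine_ys_uniq.
- by rewrite /= aA spine_ys_A.
Qed.

(** The spine [Q ++ chain] ends in [la G] and may be traversed backwards. *)
Lemma spine_enter2 a : a \in A -> a \notin ys -> e a (la G) -> hub_path.
Proof.
move=> aA ays aG.
have [nQ sQ] := coverP mcs.1 Qcs.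
have lQ : la Q \in ends Q by rewrite !inE eqxx orbT.
have := spine_sorted (perm_refl Q) sQ lQ.
set C := chain _ _ => sC.
apply: (@hub_pathI (a :: ys) cs a (rev (Q ++ C))) => //; first exact: mcs.1.
- have : hd (rev (Q ++ C)) = la G.
    rewrite head_rev; have -> : la (Q ++ C) = last (la Q) C by rewrite last_cat.
    rewrite chain_last ?last_rcons //; apply/allP => W Win.
    have Wcs : W \in cs by move: Win; rewrite in_spine !inE !mem_rcons !inE => /or3P[]->; rewrite ?orbT.
    by case: (coverP mcs.1 Wcs).
  move: sC; rewrite -sorted_rev_sym //; case: (rev _) => //= b F' -> bE.
  by rewrite bE aG.
- rewrite /= perm_cons perm_rev (permPl (perm_cat (perm_refl Q) (chain_perm _ _ _))).
  by rewrite -!cats1 !flatten_cat /=; perm_count.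
- by rewrite /= ays spine_ys_uniq.
- by rewrite /= aA spine_ys_A.
Qed.

Lemma spine_long : 1 < size Q -> hub_path.
Proof.
move=> szQ; have [nQ sQ] := coverP mcs.1 Qcs.
have [Pps PG PQ GQ] := spine_neq.
have uQ : uniq Q by apply: cover_uniq_in mcs.1 Qcs.
have hlQ : hd Q != la Q by apply: head_neq_last.
have lQ : la Q \in ends Q by rewrite !inE eqxx orbT.
have lQR : la Q \in R by apply: (cover_sub mcs.1 Qcs); apply: last_mem.
have [n1 n2] := ends_nadj mcs Pcs Qcs PQ (mem_head _ _) lQ.
have [n3 n4] := ends_nadj mcs Pcs Qcs PQ (mem_head _ _) (mem_head _ _).
have yPQ y : y \in ys -> e y (hd P) /\ e y (la Q).
  case/spine_adj=> U [V [Uin Vin _ _ yd]].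
  have Vcs : V \in cs by rewrite inE Vin orbT.
  split.
    apply: (yd P); rewrite ?Pcs ?mem_head //.
      apply/eqP => /(heads_inj Pcs Vcs) PV; move: Vin.
      by rewrite -PV !(mem_rcons, inE) (negPf PQ) (negPf PG) (negPf Pps).
    by have [->|] := eqVneq P U; rewrite ?eqxx ?orbT.
  apply: (yd Q); rewrite ?Qcs //.
    have [->|VQ] := eqVneq V Q; first by rewrite eq_sym.
    by have [_] := ends_nadj mcs Vcs Qcs VQ (mem_head _ _) lQ; rewrite eq_sym.
  apply/orP; left; apply: contraTneq spine_uniq => QU.
  by rewrite -rcons_cons rcons_uniq QU Uin.
case/orP: (arrow_total (head_R Pcs) lQR n2 n1) => /arrowP[a /linkP[aA a1 a2 ad]].
  apply: (@spine_enter1 Q a) => //.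
    by apply/negP => /yPQ[_]; apply/negP.
  by apply: ad => //; apply: head_R Qcs.
apply: (@spine_enter1 (rev Q) a) => //.
- by rewrite perm_rev.
- by rewrite sorted_rev_sym.
- by rewrite last_rev mem_head.
- by apply/negP => /yPQ[]; rewrite (negPf a2).
- by rewrite head_rev.
Qed.

End Spine.

Definition nonadj u w := (u != w) && ~~ e u w.

Lemma min_cover_heads cs : min_cover cs -> pairwise nonadj [seq hd W | W <- cs].
Proof.
move=> m; suff gen ws : uniq ws -> {subset ws <= cs} -> pairwise nonadj [seq hd W | W <- ws].
  by apply: gen => //; apply: cover_uniq_ps m.1.
elim: ws => //= W ws IH /andP[Wws uws] sub.
rewrite IH ?andbT //; last by move=> U Uin; apply: sub; rewrite inE Uin orbT.
apply/allP => _ /mapP[U Uin ->].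
have WU : W != U by apply: contraNneq Wws => ->.
have Wcs : W \in cs by rewrite sub ?mem_head.
have Ucs : U \in cs by rewrite sub // inE Uin orbT.
by have [? ?] := ends_nadj m Wcs Ucs WU (mem_head _ _) (mem_head _ _); apply/andP.
Qed.

Lemma pairwise_nonadj I : pairwise nonadj I ->
  uniq I /\ {in I &, forall x y, x != y -> ~~ e x y}.
Proof.
elim: I => //= x I IH /andP[xI /IH[uI ind]]; split.
  by rewrite uI andbT; apply/negP => /(allP xI); rewrite /nonadj eqxx.
move=> u w; rewrite !inE => /predU1P[->|uI'] /predU1P[->|wI'] //; first by rewrite eqxx.
- by have /andP[] := allP xI _ wI'.
- by have /andP[_] := allP xI _ uI'; rewrite e_sym.
- exact: ind.
Qed.

(** The set [I] has [(size I).-1] distinct connectors, too many for all of them to be in [ys]. *)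
Lemma indep_fresh I ys : pairwise nonadj I -> {subset I <= R} ->
  (size ys).+1 < size I -> exists y v, [/\ y \in A, y \notin ys &
    forall z, z \in I -> z != v -> e y z].
Proof.
move=> /pairwise_nonadj[uI ind] sI sz.
have [zs [uz az sz' zd]] := indep_links uI sI ind.
have /allPn[y yzs yys] : ~~ all [in ys] zs.
  apply/negP => /allP sub; have := uniq_leq_size uz sub.
  by rewrite sz' leqNgt -ltnS prednK ?sz //; apply: leq_trans sz.
by have [v vd] := zd _ yzs; exists y, v; split=> //; apply: (allP az).
Qed.

(** * The case where the last path is a single vertex *)

Section Short.
Variables (P : seq T) (ps : seq (seq T)) (G : seq T) (x : T).
Notation cs := (P :: rcons (rcons ps G) [:: x]).
Notation ys := (hlinks P (rcons (rcons ps G) [:: x])).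
Hypotheses (mcs : min_cover cs) (ar : path harrow P (rcons (rcons ps G) [:: x])).

Let Pin : P \in cs := Pcs P ps G [:: x].
Let Gin : G \in cs := Gcs P ps G [:: x].
Let Qin : [:: x] \in cs := Qcs P ps G [:: x].

Let xR : x \in R.
Proof. exact: (cover_sub mcs.1 Qin (mem_head _ _)). Qed.

Let lG : la G \in ends G.
Proof. by rewrite !inE eqxx orbT. Qed.

Let lGR : la G \in R.
Proof. by apply: (cover_sub mcs.1 Gin); apply: last_mem; case: (coverP mcs.1 Gin). Qed.

Lemma short_enter1 a : a \in A -> a \notin ys -> e a x -> hub_path.
Proof.
by move=> aA ays ax; apply: (spine_enter1 mcs ar (F := [:: x]) (a := a)); rewrite //= mem_head.
Qed.

(** [P] comes first, so its head is the target of no arrow of the spine. *)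
Lemma short_ys_dom y : y \in ys -> e y (hd P).
Proof.
have [Pps PG PQ GQ] := spine_neq mcs.
case/(spine_adj mcs ar) => U [V [Uin Vin _ _ yd]].
have Vcs : V \in cs by rewrite inE Vin orbT.
apply: (yd P); rewrite ?mem_head //.
  apply/eqP => /(heads_inj mcs Pin Vcs) PV; move: Vin.
  by rewrite -PV !(mem_rcons, inE) (negPf PQ) (negPf PG) (negPf Pps).
by have [->|] := eqVneq P U; rewrite ?eqxx ?orbT.
Qed.

(** Criticality is applied at [v] and [hd P]. In the first outcome [a] and [d] miss [hd P], which
    all of [ys] reach, so neither is used up. In the second, [d] cannot be in [ys]: together with
    [hd P] it would miss the target of its own arrow. What remains is [d] in [R]. *)
Lemma short_dom : hub_path \/ exists d, [/\ d \in R, e d x & e d (la G)].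
Proof.
have [Pps PG PQ GQ] := spine_neq mcs.
have [Px1 Px2] := ends_nadj mcs Pin Qin PQ (mem_head _ _) (mem_head _ _).
have [PG1 PG2] := ends_nadj mcs Pin Gin PG (mem_head _ _) lG.
have [Gx1 Gx2] := ends_nadj mcs Gin Qin GQ lG (mem_head _ _).
rewrite /= in Px1 Px2 Gx1 Gx2.
have hPR : hd P \in R := head_R mcs Pin.
have AneR a z : a \in A -> z \in R -> z != a.
  by move=> aA zR; apply: contraTneq zR => ->; apply: A_notin_R.
have [|[a [d [[aA dAR na nd] ad dom]]]|[d dAR dom]] := hub_dom hPR xR; first by rewrite eq_sym.
  have ays : a \notin ys by apply/negP => /short_ys_dom; apply/negP.
  have dys : d \notin ys by apply/negP => /short_ys_dom; apply/negP.
  have [ax|nax] := boolP (e a x); first by left; apply: short_enter1 ax.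
  have [aG|naG] := boolP (e a (la G)); first by left; apply: (spine_enter2 mcs ar aA).
  have := dom _ xR; rewrite eq_sym Px2 (negPf nax) /= => /(_ isT) dx.
  have [dA|dnA] := boolP (d \in A).
    by left; apply: (short_enter1 dA dys); case/orP: dx => // /eqP xd; have := AneR _ _ dA xR; rewrite xd eqxx.
  have dR : d \in R by move: dAR; rewrite inE (negPf dnA).
  right; exists d; split=> //.
    by case/orP: dx => // /eqP xd; have := ad dR; rewrite -xd (negPf nax).
  have := dom _ lGR; rewrite eq_sym PG2 (negPf naG) /= => /(_ isT) /orP[/eqP Gd|//].
  by have := ad dR; rewrite -Gd (negPf naG).
have := dom _ xR; rewrite eq_sym (negPf Px2) (negPf Px1) /= => dx.
have [dA|dnA] := boolP (d \in A).
  have {}dx : e d x by case/orP: dx => // /eqP xd; have := AneR _ _ dA xR; rewrite xd eqxx.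
  left; apply: (short_enter1 dA) dx; apply/negP => /(spine_adj mcs ar)[U [V [Uin Vin _ ndV _]]].
  have Vcs : V \in cs by rewrite inE Vin orbT.
  have PV : P != V.
    apply: contraTneq Vin => <-.
    by rewrite !(mem_rcons, inE) (negPf PQ) (negPf PG) (negPf Pps).
  have [V1 V2] := ends_nadj mcs Pin Vcs PV (mem_head _ _) (mem_head _ _).
  have := dom _ (head_R mcs Vcs); rewrite eq_sym (negPf V2) (negPf V1) (negPf ndV).
  by rewrite (negPf (AneR _ _ dA (head_R mcs Vcs))).
have dR : d \in R by move: dAR; rewrite inE (negPf dnA).
have := dom _ lGR; rewrite eq_sym (negPf PG2) (negPf PG1) /= => dG.
right; exists d; split=> //.
  case/orP: dx => // /eqP xd; move: dG; rewrite -xd (negPf Gx2) /=.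
  by rewrite e_sym (negPf Gx1).
by case/orP: dG => // /eqP Gd; move: dx; rewrite -Gd (negPf Gx1) orbF eq_sym (negPf Gx2).
Qed.

Lemma split_cover W L d M : W = L ++ d :: M -> W \in cs -> e d x -> W != [:: x] ->
  [/\ L != [::], M != [::], sorted e L, sorted e M & e (la L) d && e d (hd M)].
Proof.
move=> WE Win dx Wx; have [_ sW] := coverP mcs.1 Win.
have nL : L != [::].
  apply/eqP => L0; have := (ends_nadj mcs Win Qin Wx (mem_head _ _) (mem_head _ _)).1.
  by rewrite WE L0 /= dx.
have nM : M != [::].
  have lW : la W \in ends W by rewrite !inE eqxx orbT.
  apply/eqP => M0; have := (ends_nadj mcs Win Qin Wx lW (mem_head _ _)).1.
  by rewrite WE M0 /= last_cat /= dx.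
move: sW; rewrite WE (sorted_cat e x0) //= => /and3P[sL dM Ld].
have [sM hM] : sorted e M /\ e d (hd M) by case: (M) nM dM => //= b M' _ /andP[-> ->].
by rewrite Ld hM.
Qed.

(* The vertex [d] of [short_dom] is interior to some path [L d M]. Since [d] is adjacent to the
   ends [x] and [la G] of other paths, reattaching [L] and [M] around [d] yields further minimum
   covers. So the ends of [L] and [M] at [d] are ends of paths in minimum covers, the resulting
   independent set is larger than the number of paths, and it has more connectors than [ys]. *)
Lemma spine_short : hub_path.
Proof.
have [//|[d [dR dx dG]]] := short_dom.
have [Pps PG PQ GQ] := spine_neq mcs.
have : d \in flatten cs by rewrite (cover_mem d mcs.1).
case/flattenP => W Win dW.
have Wx : W != [:: x].
  by apply: contraTneq dW => ->; rewrite inE; apply: contraTneq dx => ->; rewrite e_irr.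
have [L [M WE]] : exists L M, W = L ++ d :: M by case/splitPr: dW => L M; exists L, M.
have [nL nM sL sM /andP[Ld dM]] := split_cover WE Win dx Wx.
have nrL : rev L != [::] by rewrite rev_eq0.
have sxM : sorted e (x :: d :: M).
  by rewrite /= e_sym dx; case: (M) nM sM dM => //= b M' _ -> ->.
have /= /andP[xd pdM] := sxM.
have sLx : sorted e (L ++ [:: d; x]).
  by rewrite (sorted_cat e x0) //= sL dx Ld.
have nLx : L ++ [:: d; x] != [::] by case: (L).
have lLW : la L \in R by apply: (cover_sub mcs.1 Win); rewrite WE mem_cat last_mem.
have hMW : hd M \in R by apply: (cover_sub mcs.1 Win); rewrite WE mem_cat inE head_mem ?orbT.
have szys : size ys = (size ps).+2 by rewrite size_pairmap size_map !size_rcons.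
have [WG|WG] := eqVneq W G.
  have perm_cs : perm_eq cs (G :: [:: x] :: P :: ps).
    by rewrite -!cats1; perm_count.
  have m1 := min_cover_perm perm_cs mcs.
  have [/= /and3P[_ nP aps] pR1] := andP m1.1.
  have GE : G = L ++ d :: M by rewrite -WG.
  have lGM : la G = la M by rewrite GE last_mid.
  (* Each of the three covers makes two of [la L], [hd M] and [x] heads of distinct paths; no single
     one does this for all three. *)
  have mA : min_cover (rev L :: (x :: d :: M) :: P :: ps).
    apply: min_rev1; apply: (min_cover_size m1) => //.
    apply/andP; split; first by rewrite /= nL sL nP aps xd pdM.
    by rewrite -(permPr pR1) GE; perm_count.
  have mB : min_cover (M :: rev (L ++ [:: d; x]) :: P :: ps).
    apply: min_rev2; apply: (min_cover_size m1) => //.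
    apply/andP; split; first by rewrite /= nM sM nLx sLx nP.
    by rewrite -(permPr pR1) GE; perm_count.
  have mC : min_cover (rev L :: (M ++ [:: d; x]) :: P :: ps).
    apply: min_rev1; apply: (min_cover_size m1) => //.
    apply/andP; split.
      rewrite /= nL sL nP aps (sorted_cat e x0) //= sM dx e_sym -lGM dG.
      by case: (M) nM.
    by rewrite -(permPr pR1) GE; perm_count.
  have I1 := min_cover_heads mA; have I2 := min_cover_heads mB; have I3 := min_cover_heads mC.
  rewrite /= head_rev in I1; rewrite /= head_rev last_cat_ne //= in I2.
  rewrite /= head_rev head_cat // in I3.
  case/andP: I1 => /andP[I1a I1b] I1c; case/andP: I2 => I2a _; case/andP: I3 => /andP[I3a _] _.
  have [|||y [v [yA yys yd]]] := @indep_fresh (la L :: hd M :: x :: [seq hd W | W <- P :: ps]) ys.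
  - by rewrite /= I3a I1a I2a I1c I1b.
  - move=> z; do 2![rewrite in_cons => /predU1P[->//|]].
    rewrite in_cons => /predU1P[->|/mapP[U Uin ->]] //.
    by apply: (head_R mcs); rewrite in_spine; move: Uin; rewrite inE => /orP[]->; rewrite ?orbT.
  - by rewrite szys /= size_map.
  (* [y] misses at most [v]. Unless this is [x], the path is entered at [x], and otherwise at its
     far end. *)
  have [vx|vx] := eqVneq x v; last first.
    by apply: (short_enter1 yA yys); apply: yd => //; rewrite !inE eqxx !orbT.
  (* [G] is traversed with [M] reversed, so that it ends in [hd M]. *)
  have [G' G'E] : exists G', G' = L ++ d :: rev M by eexists.
  have hG' : hd G' = hd G by rewrite G'E GE !head_cat.
  have ysE : hlinks P (rcons (rcons ps G') [:: x]) = ys by rewrite !map_rcons hG'.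
  have m' : min_cover (P :: rcons (rcons ps G') [:: x]).
    apply: (@min_cover_perm (G' :: [:: x] :: P :: ps)).
      by rewrite -!cats1; perm_count.
    apply: (min_cover_size m1) => //; apply/andP; split.
      rewrite /= nP aps G'E (sorted_cat e x0) //= sL Ld.
      have : sorted e (d :: rev M).
        rewrite -cat1s (sorted_cat e x0) ?rev_eq0 //= sorted_rev_sym // sM head_rev.
        by rewrite -lGM dG.
      by move=> /= ->; case: (L) nL.
    by rewrite -(permPr pR1) GE G'E; perm_count.
  have ar' : path harrow P (rcons (rcons ps G') [:: x]).
    have pm U Us : path harrow U Us = path arrow (hd U) [seq hd W | W <- Us].
      by rewrite path_map.
    by move: ar; rewrite !pm !map_rcons hG'.
  apply: (spine_enter2 m' ar' yA); first by rewrite ysE.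
  rewrite G'E last_cat_ne //= -[last d _]/(la (d :: rev M)).
  have -> : la (d :: rev M) = hd M by rewrite -(last_rev x0 M) (last_mid x0 [::]) ?rev_eq0.
  apply: yd; rewrite ?inE ?eqxx ?orbT //.
  by rewrite -vx; case/andP: I2a => /andP[].
have WPps : W \in P :: ps.
  move: Win; rewrite in_spine inE (negPf WG) (negPf Wx) !orbF //.
set rs := rem W (P :: ps).
have perm_cs : perm_eq cs (W :: G :: [:: x] :: rs).
  have := perm_to_rem WPps; rewrite -/rs => /permP pq; rewrite -!cats1.
  by apply/permP => p; have := pq p; rewrite /= !count_cat /=; clear; lia.
have m1 := min_cover_perm perm_cs mcs.
have [/= /and3P[_ /andP[nG sG] aps] pR1] := andP m1.1.
have mA : min_cover (rev L :: (x :: d :: M) :: rev G :: rs).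
  apply: min_rev1; apply: (min_cover_size m1) => //.
  apply/andP; split.
    by rewrite /= nL sL aps rev_eq0 nG sorted_rev_sym // sG xd pdM.
  by rewrite -(permPr pR1) WE; perm_count.
have mB : min_cover (M :: rev (L ++ [:: d; x]) :: rev G :: rs).
  apply: min_rev2; apply: (min_cover_size m1) => //.
  apply/andP; split; first by rewrite /= nM sM nLx sLx rev_eq0 nG sorted_rev_sym // sG.
  by rewrite -(permPr pR1) WE; perm_count.
have mC : min_cover (rev L :: M :: (x :: d :: rev G) :: rs).
  apply: min_rev1; apply: (min_cover_size m1) => //.
  apply/andP; split.
    rewrite /= nL sL aps nM sM e_sym dx /= andbT.
    rewrite -[path _ _ _]/(sorted e ([:: d] ++ rev G)) (sorted_cat e x0) ?rev_eq0 //=.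
    by rewrite sorted_rev_sym // sG head_rev dG.
  by rewrite -(permPr pR1) WE; perm_count.
have I1 := min_cover_heads mA; have I2 := min_cover_heads mB; have I3 := min_cover_heads mC.
rewrite /= !head_rev in I1; rewrite /= !head_rev last_cat_ne //= in I2.
rewrite /= head_rev in I3.
case/andP: I1 => I1a /andP[I1b I1c]; case/andP: I2 => I2a _; case/andP: I3 => /andP[I3a _] _.
have [|||y [v [yA yys yd]]] := @indep_fresh (la L :: hd M :: x :: la G :: [seq hd W | W <- rs]) ys.
- by rewrite /= I3a I2a I1b I1c; move: I1a => /= ->.
- move=> z; do 3![rewrite in_cons => /predU1P[->//|]].
  rewrite in_cons => /predU1P[->|/mapP[U Uin ->]] //.
  by apply: (head_R mcs); rewrite (perm_mem perm_cs) !inE Uin !orbT.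
- by rewrite szys /= size_map size_rem.
have [vx|vx] := eqVneq x v; last first.
  by apply: (short_enter1 yA yys); apply: yd => //; rewrite !inE eqxx !orbT.
apply: (spine_enter2 mcs ar yA yys); apply: yd; rewrite ?inE ?eqxx ?orbT //.
by rewrite -vx eq_sym; case/andP: I1b => /andP[].
Qed.

End Short.

Lemma min_cover_hub ps : min_cover ps -> hub_path \/ ps = [::].
Proof.
case: ps => [|P [|Q [|Q' ps]]] m; [by right | by left; apply: hub_path1 m
  | by left; apply: hub_path2 m | left].
have ucs := cover_uniq_ps m.1.
have [|cs pcs scs] := @tournament_path _ harrow _ ucs.
  move=> U W Uin Win UW.
  have [n1 n2] := ends_nadj m Uin Win UW (mem_head _ _) (mem_head _ _).
  have hR Z : Z \in [:: P, Q, Q' & ps] -> hd Z \in R.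
    move=> Zin; have [nZ _] := coverP m.1 Zin.
    exact: (cover_sub m.1 Zin (head_mem _ nZ)).
  exact: arrow_total (hR _ Uin) (hR _ Win) n2 n1.
have {}m : min_cover cs by apply: min_cover_perm m; rewrite perm_sym.
have szcs := perm_size pcs; case: cs scs m szcs {pcs} => [//|P1 cs] /= sc m [szcs].
case/lastP: cs sc m szcs => [//|cs X]; rewrite size_rcons => sc m [szcs].
case/lastP: cs sc m szcs => [//|cs G] sc m _.
have [szX|szX] := ltnP 1 (size X); first exact: spine_long m sc szX.
have [nX _] := coverP m.1 (Qcs P1 cs G X).
case: X nX szX sc m => [|x [|//]] //= _ _ sc m.
exact: spine_short m sc.
Qed.

End Base.


(** Minimality of a cover is not decided here, so descent on the number of paths yields a minimum
    cover only under a double negation. *)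
Lemma min_cover_notnot (B : Prop) ps :
  (forall qs, min_cover qs -> B) -> cover ps -> ~ ~ B.
Proof.
move=> mB; have [n] := ubnP (size ps).
elim: n ps => // n IH ps szps c nB.
apply: (nB); apply: (mB ps); split=> // qs cq; rewrite leqNgt; apply/negP => lt.
exact: IH (leq_trans lt szps) cq nB.
Qed.

Lemma clique_path a B Z : uniq (a :: B) -> all [in A] (a :: B) -> sorted e Z ->
  (if Z is z :: _ then (z \in A) && (z \notin a :: B) else true) -> path e a (B ++ Z).
Proof.
elim: B a => [|b B IH] a /=.
  by case: Z => //= z Z _ /andP[aA _] -> /andP[zA za]; rewrite A_clique // eq_sym -mem_seq1.
case/andP=> [/norP[ab aB] u] /and3P[aA bA BA] sZ hZ.
rewrite A_clique //=; apply: IH => //=; first by rewrite bA.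
by case: Z hZ {sZ} => // z Z; rewrite !inE !negb_or => /and3P[-> _ ->].
Qed.

Definition hub_start (t : seq T) := if t is z :: _ then z \in A else false.

(** Over tuples of fixed length existence is a boolean, which lets [hub_hamilton] remove the double
    negation. *)
Lemma hub_path_tuple : A != set0 -> hub_path -> exists t : #|A :|: R|.-tuple T,
  [&& sorted e t, perm_eq t (enum (A :|: R)) & hub_start t].
Proof.
move=> /set0Pn[a0 a0A] [a [Z [ys [aA pZ pq uy ay]]]].
have ysA z : z \in ys -> z \in A by apply: (allP ay).
have uq : uniq (a :: Z).
  rewrite (perm_uniq pq) cat_uniq uy enum_uniq andbT /=; apply/hasPn => z.
  by rewrite mem_enum; apply: contraL => /ysA; apply: A_notin_R.
have mZ z : (z \in a :: Z) = (z \in ys) || (z \in R) by rewrite (perm_mem pq) mem_cat mem_enum.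
pose B := [seq b <- enum A | b \notin a :: Z].
pose t := B ++ a :: Z.
have ut : uniq t.
  rewrite cat_uniq uq filter_uniq ?enum_uniq // andbT andTb.
  by apply/hasPn => z zZ; change (z \notin B); rewrite mem_filter zZ.
have mt z : (z \in t) = (z \in A :|: R).
  rewrite mem_cat mem_filter mem_enum mZ in_setU.
  case: (z \in ys) (@ysA z) => [/(_ isT)->|_] //=.
  by case: (z \in R); rewrite ?orbT ?orbF.
have pt : perm_eq t (enum (A :|: R)).
  by apply: uniq_perm; rewrite ?enum_uniq // => z; rewrite mt mem_enum.
have st : size t == #|A :|: R| by rewrite (perm_size pt) cardE.
exists (Tuple st); rewrite /= pt andTb.
rewrite /t; have: all [in A] B.
  by apply/allP => b; rewrite mem_filter mem_enum => /andP[].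
have: uniq B by rewrite filter_uniq ?enum_uniq.
have: a \notin B by rewrite mem_filter mem_head.
case: (B) => [|b B'] /= aB uB AB; first by rewrite pZ aA.
case/andP: (AB) => -> _; rewrite andbT; apply: clique_path => //=.
by rewrite aA.
Qed.

Lemma hub_hamilton : A != set0 ->
  exists a Z, [/\ a \in A, path e a Z & perm_eq (a :: Z) (enum (A :|: R))].
Proof.
move=> A0; have [/existsP[t /and3P[]]|/existsP no] := boolP [exists t : #|A :|: R|.-tuple T,
    [&& sorted e t, perm_eq t (enum (A :|: R)) & hub_start t]].
  by case: (tval t) => //= a Z pZ pq aA; exists a, Z.
exfalso.
have c1 : cover [seq [:: x] | x <- enum R].
  apply/andP; split; first by apply/allP => _ /mapP[x _ ->].
  by rewrite flatten_map1 map_id.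
have [a0 a0A] := set0Pn _ A0.
apply: (min_cover_notnot (B := hub_path)) c1 _ => [qs m|hp]; last first.
  by apply: no; apply: hub_path_tuple.
have [//|q0] := min_cover_hub a0 m.
exists a0, [::], [:: a0]; split=> //=; last by rewrite a0A.
have [_] := andP m.1; rewrite q0 /= => pR.
by rewrite perm_cons.
Qed.

End Hub.

(** * Connected dominating sets and cut vertices *)

Section Connectivity.

Variable T : finType.
Implicit Types (e : rel T) (S D X Y : {set T}) (u v x y z : T).

(** Most uses of connectedness take this form. With non-membership in a set as [Pr], it yields an
    edge entering that set. *)
Lemma conn_ind e S x y (Pr : T -> Prop) : connected_in e S -> x \in S -> y \in S ->
  Pr x -> (forall a b, a \in S -> b \in S -> e a b -> Pr a -> Pr b) -> Pr y.
Proof.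
case/andP=> _ /forall_inP con xS yS Px step.
have /connectP[p pp ->] := forall_inP (con x xS) y yS.
elim: p x xS Px pp {con yS} => //= a p IH x xS Px /andP[/and3P[_ aS xa] pp].
by apply: IH pp; rewrite //; apply: step xa Px.
Qed.

Lemma connect_stepI e S x y z : connect (induced e S) x y ->
  y \in S -> z \in S -> e y z -> connect (induced e S) x z.
Proof.
by move=> xy yS zS yz; apply: connect_trans xy _; apply: connect1; rewrite /induced /= yS zS.
Qed.

Lemma induced_sym e S : symmetric e -> symmetric (induced e S).
Proof. by move=> e_sym x y; rewrite /induced /= e_sym andbCA. Qed.

Lemma connected_inI e S x : symmetric e -> x \in S ->
  (forall y, y \in S -> connect (induced e S) x y) -> connected_in e S.
Proof.
move=> e_sym xS con; apply/andP; split; first by apply/set0Pn; exists x.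
apply/forall_inP => y yS; apply/forall_inP => z zS.
apply: connect_trans (con z zS).
by rewrite (sym_connect_sym (induced_sym S e_sym)) con.
Qed.

Lemma connectedP e S x y : connected_in e S -> x \in S -> y \in S ->
  connect (induced e S) x y.
Proof. by case/andP=> _ /forall_inP con xS yS; apply: (forall_inP (con x xS)). Qed.

Lemma connect_mono e1 e2 S1 S2 :
  {in S1 &, forall x y, e1 x y -> e2 x y} -> S1 \subset S2 ->
  subrel (connect (induced e1 S1)) (connect (induced e2 S2)).
Proof.
move=> e12 /subsetP S12; apply: connect_sub => x y /and3P[xS yS xy].
by apply: connect1; rewrite /induced /= !S12 // e12.
Qed.

Lemma connected_in_mono e1 e2 S : {in S &, forall x y, e1 x y -> e2 x y} ->
  connected_in e1 S -> connected_in e2 S.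
Proof.
move=> e12 /andP[S0 /forall_inP con]; apply/andP; split=> //.
apply/forall_inP => x xS; apply/forall_inP => y yS.
by apply: (connect_mono e12 (subxx S)); apply: (forall_inP (con x xS)).
Qed.

Lemma connected_inU e D1 D2 v : symmetric e -> connected_in e D1 -> connected_in e D2 ->
  v \in D1 -> v \in D2 -> connected_in e (D1 :|: D2).
Proof.
move=> e_sym c1 c2 v1 v2; apply: (@connected_inI _ _ v) => //; first by rewrite inE v1.
move=> y; rewrite inE => /orP[yD|yD].
  by apply: (connect_mono _ (subsetUl D1 D2)) (connectedP c1 v1 yD).
by apply: (connect_mono _ (subsetUr D1 D2)) (connectedP c2 v2 yD).
Qed.

Lemma connected_in_set1 e v : connected_in e [set v].
Proof.
apply/andP; split; first by apply/set0Pn; exists v; rewrite inE.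
by apply/forall_inP => x /set1P->; apply/forall_inP => y /set1P->; apply: connect0.
Qed.

Lemma connected_inU1 e D v w : symmetric e -> connected_in e D -> w \in D -> e w v ->
  connected_in e (v |: D).
Proof.
move=> e_sym cD wD wv; apply: (@connected_inI _ _ w) => //; first by rewrite !inE wD orbT.
move=> y; rewrite !inE => /predU1P[->|yD].
  by apply: connect1; rewrite /induced /= !inE eqxx wD orbT.
by apply: (connect_mono _ (subsetUr _ D)) (connectedP cD wD yD).
Qed.

(* Collapsing everything outside [S] to [v] maps walks of [D] to walks of [D :&: (v |: S)]. *)
Lemma connected_in_retract e D S v : symmetric e -> connected_in e D -> v \in D ->
  (forall x y, x \in D -> x \in S -> y \in D -> e x y -> y \in v |: S) ->
  connected_in e (D :&: (v |: S)).
Proof.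
move=> e_sym cD vD clS; apply: (@connected_inI _ _ v) => //; first by rewrite !inE eqxx vD.
move=> y /setIP[yD yS]; move: y yD yS.
move=> y yD; apply: (conn_ind (Pr := fun z => z \in v |: S ->
  connect (induced e (D :&: (v |: S))) v z) cD vD yD) => [_|a b aD bD ab IH bS].
  exact: connect0.
have [->|bv] := eqVneq b v; first exact: connect0.
have bS' : b \in S by move: bS; rewrite !inE (negPf bv).
have aS : a \in v |: S by apply: (clS b) => //; rewrite e_sym.
by apply: connect_stepI (IH aS) _ _ ab; rewrite inE ?aD ?bD.
Qed.

(* [S] is a union of components of [G - v], neither none nor all of them. *)
Definition sep e v S := [&& S != set0, v \notin S, v |: S != setT
  & [forall x in S, forall y, e x y ==> (y \in v |: S)]].

Lemma sepP e v S : sep e v S ->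
  [/\ exists x, x \in S, v \notin S, exists x, x \notin v |: S
    & forall x y, x \in S -> e x y -> y \in v |: S].
Proof.
case/and4P=> /set0Pn S0 vS ST /forall_inP cl; split=> //.
  have : ~: (v |: S) != set0 by apply: contraNneq ST => E; rewrite -(setCK (_ |: _)) E setC0.
  by case/set0Pn=> x; rewrite inE => xS; exists x.
by move=> x y xS; apply/implyP; apply: (forallP (cl x xS)).
Qed.

Lemma sepC e v S : symmetric e -> sep e v S -> sep e v (~: (v |: S)).
Proof.
move=> e_sym /sepP[[x xS] vS [y yS] cl]; apply/and4P; split.
- by apply/set0Pn; exists y; rewrite inE.
- by rewrite !inE eqxx.
- apply/eqP => /setP/(_ x); rewrite !inE xS orbT orbF => /eqP xv.
  by rewrite -xv xS in vS.
apply/forall_inP => a; rewrite !inE negb_or => /andP[av aS]; apply/forallP => b.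
apply/implyP => ab; rewrite !inE; have [//|bv /=] := eqVneq b v.
by apply: contraNN aS => bS; have := cl b a bS; rewrite e_sym ab !inE (negPf av); apply.
Qed.

Lemma domP e D : reflect (forall x, x \notin D -> exists2 y, y \in D & e x y) (dominating e D).
Proof.
apply: (iffP forallP) => dom x; first by move=> xD; apply/exists_inP; apply: (implyP (dom x)).
by apply/implyP => xD; apply/exists_inP; apply: dom.
Qed.

(** Without [v], the connected set [D] would stay on one side of [v] and dominate nothing on the
    other. *)
Lemma cds_cut e D v S : symmetric e -> connected_dominating e D -> sep e v S -> v \in D.
Proof.
move=> e_sym /andP[/domP dom cD]; have /andP[/set0Pn[x xD] _] := cD.
wlog xS : S / x \in S.
  move=> wl s; have [xv|xv] := eqVneq x v; first by rewrite -xv.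
  have [xS|xS] := boolP (x \in S); first exact: wl s.
  by apply: (wl (~: (v |: S))); [rewrite !inE negb_or xv | exact: sepC].
case/sepP=> _ vS [y yS] cl; apply: contraNT yS => vD.
have DS z : z \in D -> z \in S.
  move=> zD; apply: (conn_ind (Pr := fun z => z \in S) cD xD zD) => // a b _ bD ab aS.
  have := cl _ _ aS ab; rewrite !inE => /orP[/eqP bv|//].
  by rewrite -bv bD in vD.
have [yD|/dom[z zD yz]] := boolP (y \in D); first by rewrite !inE DS ?orbT.
by apply: (cl z); rewrite ?DS // e_sym.
Qed.

(* The trace on [S] of a connected dominating set; the cut vertex [v] belongs to every such set. *)
Definition good e v S X := [/\ X \subset S, connected_in e (v |: X)
  & forall x, x \in S -> x \notin X -> exists2 y, y \in v |: X & e x y].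

Lemma cds_good e D v S : symmetric e -> connected_dominating e D -> sep e v S ->
  good e v S (D :&: S).
Proof.
move=> e_sym cdD s; have vD := cds_cut e_sym cdD s.
have /andP[/domP dom cD] := cdD; have [_ vS _ cl] := sepP s.
have E : v |: D :&: S = D :&: (v |: S).
  by apply/setP => z; rewrite !inE; case: eqP => // ->; rewrite vD.
split; first exact: subsetIr.
  by rewrite E; apply: connected_in_retract => // x y _ xS _; apply: cl.
move=> x xS; rewrite inE xS andbT => /dom[y yD xy]; exists y => //.
by rewrite E inE yD (cl x).
Qed.

(** Traces on the two sides are glued at [v]; this is what makes size comparisons local to one
    side. *)
Lemma good_cds e v S X Y : symmetric e -> good e v S X -> good e v (~: (v |: S)) Y ->
  connected_dominating e (v |: (X :|: Y)).
Proof.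
move=> e_sym [XS cX dX] [YS cY dY]; have E : v |: (X :|: Y) = (v |: X) :|: (v |: Y).
  by apply/setP => z; rewrite !inE; case: (z == v).
apply/andP; split; last first.
  by rewrite E; apply: (connected_inU (v := v)) => //; rewrite !inE eqxx.
apply/domP => x; rewrite E inE negb_or => /andP[]; rewrite !inE !negb_or.
move=> /andP[xv xX] /andP[_ xY]; have [xS|xS] := boolP (x \in S).
  by have [y yX xy] := dX x xS xX; exists y; rewrite // !inE in yX *; case/orP: yX => ->; rewrite ?orbT.
have [|y yY xy] := dY x _ xY; first by rewrite !inE negb_or xv.
by exists y; rewrite // !inE in yY *; case/orP: yY => ->; rewrite ?orbT.
Qed.

Lemma good_mono e1 e2 v S X : {in v |: S &, forall x y, e1 x y -> e2 x y} ->
  good e1 v S X -> good e2 v S X.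
Proof.
move=> e12 [XS cX dX]; have /subsetP XS' : v |: X \subset v |: S by apply: setUS.
split=> //; first by apply: connected_in_mono cX => x y /XS' xS /XS' yS; apply: e12.
move=> x xS xX; have [y yX xy] := dX x xS xX; exists y => //.
by apply: e12 xy; [rewrite !inE xS orbT | apply: XS'].
Qed.

(** * The effect of an added edge *)

Lemma add_edge_sym e u w : symmetric e -> symmetric (add_edge e u w).
Proof.
by move=> e_sym x y; rewrite /add_edge /= e_sym [(x == u) && _]andbC [(x == w) && _]andbC [X in _ || X]orbC.
Qed.

Lemma add_edgeP e u w x y :
  reflect [\/ e x y, x = u /\ y = w | x = w /\ y = u] (add_edge e u w x y).
Proof.
apply: (iffP or3P) => -[H|H|H]; try by constructor 1.
- by constructor 2; case/andP: H => /eqP-> /eqP->.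
- by constructor 3; case/andP: H => /eqP-> /eqP->.
- by constructor 2; case: H => -> ->; rewrite !eqxx.
- by constructor 3; case: H => -> ->; rewrite !eqxx.
Qed.

Lemma add_edge_swap e u w D :
  connected_dominating (add_edge e u w) D = connected_dominating (add_edge e w u) D.
Proof.
have E x y : add_edge e u w x y = add_edge e w u x y.
  by rewrite /add_edge /= [X in _ || X]orbC.
congr (_ && _).
  apply: eq_forallb => x; congr (_ ==> _); apply: eq_existsb => y.
  by rewrite E.
congr (_ && _); apply: eq_forallb => x; congr (_ ==> _).
apply: eq_forallb => y; congr (_ ==> _); apply: eq_connect => a b.
by rewrite /induced /= E.
Qed.

Lemma add_edge_old e u w x y : e x y -> add_edge e u w x y.
Proof. by rewrite /add_edge /= => ->. Qed.

Lemma sep_add e v S u w : u \in v |: S -> w \in v |: S -> sep e v S ->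
  sep (add_edge e u w) v S.
Proof.
move=> uS wS /and4P[S0 vS ST /forall_inP cl]; apply/and4P; split=> //.
apply/forall_inP => x xS; apply/forallP => y; apply/implyP.
by case/add_edgeP=> [xy|[_ ->]|[_ ->]] //; apply: (implyP (forallP (cl x xS) y)).
Qed.

Lemma add_cds e u w D : connected_dominating (add_edge e u w) D ->
  u \notin D -> w \notin D -> connected_dominating e D.
Proof.
move=> /andP[/domP dom cD] uD wD; apply/andP; split.
  apply/domP => x xD; have [y yD] := dom x xD.
  case/add_edgeP=> [xy|[_ yE]|[_ yE]]; first by exists y.
    by rewrite -yE yD in wD.
  by rewrite -yE yD in uD.
apply: connected_in_mono cD => x y xD yD /add_edgeP[//|[xE]|[xE]].
  by rewrite -xE xD in uD.
by rewrite -xE xD in wD.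
Qed.

(** With [w] outside [D], the new edge can only serve to dominate [w]. *)
Lemma add_cds1 e u w D : connected_dominating (add_edge e u w) D ->
  u \in D -> w \notin D ->
  connected_in e D /\ (forall x, x \notin D -> x != w -> exists2 y, y \in D & e x y).
Proof.
move=> /andP[/domP dom cD] uD wD; split.
  apply: connected_in_mono cD => x y xD yD /add_edgeP[//|[_ yE]|[xE]].
    by rewrite -yE yD in wD.
  by rewrite -xE xD in wD.
move=> x xD xw; have [y yD] := dom x xD.
case/add_edgeP=> [xy|[xE _]|[xE _]]; first by exists y.
  by rewrite xE uD in xD.
by rewrite xE eqxx in xw.
Qed.

End Connectivity.

(** * Criticality on one side of a cut vertex *)

(** [d] is [a] itself when [X] is a singleton. *)
Lemma card_le2 (T : finType) (X : {set T}) a : #|X| <= 2 -> a \in X ->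
  exists2 d, d \in X & forall y, y \in X -> (y == a) || (y == d).
Proof.
move=> X2 aX; case: (pickP [pred d in X | d != a]) => [d /andP[dX da]|no].
  exists d => // y yX; apply: contraLR X2; rewrite negb_or -ltnNge => /andP[ya yd].
  by apply/card_gt2P; exists y, d, a; split; split; rewrite // eq_sym.
by exists a => // y yX; move: (no y) => /=; rewrite yX => /= /negbFE->.
Qed.

Section Critical.

Variables (T : finType) (e : rel T) (k : nat).
Hypotheses (e_sym : symmetric e) (e_irr : irreflexive e) (conn : connected_graph e).
Hypothesis kmin : forall S, connected_dominating e S -> k <= #|S|.
Hypothesis kadd : forall u w, u != w -> ~~ e u w ->
  exists2 S, connected_dominating (add_edge e u w) S & #|S| < k.

Implicit Types (S D X Y : {set T}) (u v w x y z : T).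

Let a_sym u w := add_edge_sym u w e_sym.

(** Gluing the trace of [D] off [S] to a good [X] gives a connected dominating set of the graph
    itself, since the new edge is invisible on the other side. It has at least [k] vertices, while
    [D] has fewer. *)
Lemma local_crit v S u w : sep e v S -> u \in v |: S -> w \in v |: S ->
  u != w -> ~~ e u w -> exists D, [/\ connected_dominating (add_edge e u w) D,
    #|D| < k, v \in D & forall X, good e v S X -> #|D :&: S| < #|X|].
Proof.
move=> s uS wS uw nuw; have [D cD Dk] := kadd uw nuw; exists D.
have s' := sep_add uS wS s; have vD := cds_cut (@a_sym u w) cD s'.
split=> // X gX; have [_ vS _ _] := sepP s.
have gY : good e v (~: (v |: S)) (D :&: ~: (v |: S)).
  apply: good_mono (cds_good (@a_sym u w) cD (sepC (@a_sym u w) s')).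
  have both z : z \in v |: S -> z \in v |: ~: (v |: S) -> z = v.
    by rewrite !inE; case: eqP => //= _ ->.
  move=> x y xv yv /add_edgeP[//|[xE yE]|[xE yE]]; case/eqP: uw; rewrite xE yE in xv yv.
    by rewrite (both u) // (both w).
  by rewrite (both u) // (both w).
have kX : k <= #|X| + #|D :\: S|.
  apply: leq_trans (kmin (good_cds e_sym gX gY)) _.
  apply: leq_trans (leq_card_setU _ _); apply: subset_leq_card.
  apply/subsetP => z; rewrite !inE => /predU1P[->|/orP[->//|/andP[-> /norP[_ ->]]]].
    by rewrite vD vS orbT.
  by rewrite orbT.
by have := cardsID S D; lia.
Qed.

(* Otherwise a set witnessing criticality at [ab] contains [v], and the walk [a v b] makes the
   added edge superfluous. *)
Lemma sep_clique v S a b : sep e v S -> a \in S -> b \in S -> e v a -> e v b ->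
  a != b -> e a b.
Proof.
move=> s aS bS va vb ab; apply: contraT => nab.
have [D cD] := kadd ab nab; rewrite ltnNge => /negP[]; apply: kmin.
have s' : sep (add_edge e a b) v S by apply: sep_add; rewrite // !inE (aS, bS) orbT.
have vD := cds_cut (@a_sym a b) cD s'; have /andP[/domP dom cDc] := cD.
apply/andP; split.
  apply/domP => x xD; have [y yD] := dom x xD.
  case/add_edgeP=> [xy|[-> _]|[-> _]]; first by exists y.
    by exists v => //; rewrite e_sym.
  by exists v => //; rewrite e_sym.
apply: (connected_inI (x := v)) => // y yD.
have := connectedP cDc vD yD; apply: connect_sub => p q /and3P[pD qD].
case/add_edgeP=> [pq|[pE qE]|[pE qE]].
- by apply: connect1; rewrite /induced /= pD qD.
- apply: (@connect_stepI _ e D p v q) => //; last by rewrite qE.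
  by apply: connect1; rewrite /induced /= pD vD pE e_sym.
- apply: (@connect_stepI _ e D p v q) => //; last by rewrite qE.
  by apply: connect1; rewrite /induced /= pD vD pE e_sym.
Qed.

Lemma conn_total x y (Pr : T -> Prop) : Pr x ->
  (forall a b, e a b -> Pr a -> Pr b) -> Pr y.
Proof.
by move=> Px step; apply: (conn_ind conn (in_setT x) (in_setT y) Px) => a b _ _; apply: step.
Qed.

Definition cutv v := [exists S, sep e v S].

(** * An end satisfies the hypotheses on [A] and [R] *)

Section EndBlock.

Variables (v : T) (S X0 : {set T}).
Hypotheses (sS : sep e v S) (nocut : {in S, forall x, ~~ cutv x}).
Hypotheses (gX0 : good e v S X0) (X03 : #|X0| <= 3).

Let A := [set x in S | e v x].
Let R := S :\: A.

Let R_P x : x \in R -> x \in S /\ ~~ e v x.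
Proof. by rewrite !inE => /andP[+ xS]; rewrite xS. Qed.

Let RS x : x \in R -> x \in v |: S.
Proof. by case/R_P=> xS _; rewrite !inE xS orbT. Qed.

Let vS : v \notin S. Proof. by case: (sepP sS). Qed.

Let cl x y : x \in S -> e x y -> y \in v |: S.
Proof. by case: (sepP sS) => _ _ _; apply. Qed.

Let cl' x y : x \in S -> e y x -> (y == v) || (y \in S).
Proof. by move=> xS yx; have := cl xS; rewrite -in_setU1; apply; rewrite e_sym. Qed.

(** [D] reaches [S] from [v] only through [A], so one of its at most two vertices there lies in [A];
    the other, if not adjacent to [v], hangs on the first. *)
Lemma small_conn D z : connected_in e D -> v \in D -> #|D :&: S| <= 2 -> z \in D :&: S ->
  exists a d, [/\ a \in D :&: A, d \in D :&: S,
    forall y, y \in D :&: S -> (y == a) || (y == d) & d \in R -> e a d].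
Proof.
move=> cD vD D2 /setIP[zD zS].
have /existsP[a aDA] : [exists a, a \in D :&: A].
  apply: contraT; rewrite negb_exists => /forallP no.
  suff : z \notin S by rewrite zS.
  apply: (conn_ind (Pr := fun z => z \notin S) cD vD zD) => // a b aD bD ab aS.
  apply/negP => bS; have := cl' bS ab; rewrite (negPf aS) orbF => /eqP av.
  by case/negP: (no b); rewrite !inE bD bS -av.
have [aD aS va] : [/\ a \in D, a \in S & e v a] by move: aDA; rewrite !inE => /and3P[].
have [|d dDS all] := card_le2 D2 (a := a); first by rewrite inE aD.
exists a, d; split=> // /R_P[dS nvd].
apply: contraT => nad; have dD : d \in D by case/setIP: dDS.
suff : d != d by rewrite eqxx.
apply: (conn_ind (Pr := fun z => z != d) cD vD dD); first by apply: contraNneq vS => ->.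
move=> p q pD qD pq pd; apply: contraNneq nad => qd; rewrite -qd.
have := cl' (x := q); rewrite {1}qd => /(_ _ dS pq) /orP[/eqP pv|pS].
  by rewrite -pv -qd pq in nvd.
have := all p; rewrite inE pD => /(_ pS); rewrite (negPf pd) orbF => /eqP <-.
by [].
Qed.

(** As [u] is not adjacent to [v], the trace of [D] on [S] is [u] and the vertex of [A] attaching it
    to [v]. Whatever [D] dominates in [R] is dominated by these two. *)
Lemma end_arrow1 D u w : connected_in e D -> v \in D -> #|D :&: S| <= 2 ->
  u \in R -> w \in R -> u \in D ->
  (forall x, x \notin D -> x != w -> exists2 y, y \in D & e x y) ->
  (forall y, y \in D -> ~~ e w y) -> arrow e A R u w.
Proof.
move=> cD vD D2 uR wR uD dom und; have [uS nvu] := R_P uR.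
have [|a [d [aDA dDS all ad]]] := small_conn cD vD D2 (z := u); first by rewrite inE uD.
have [aD aA] := setIP aDA.
have ua : u != a by apply: contraNneq nvu => ->; move: aA; rewrite inE => /andP[].
have du : d = u.
  by have := all u; rewrite inE uD uS (negPf ua) => /(_ isT)/eqP.
apply/existsP; exists a; apply/and4P; split=> //; first by rewrite -du ad // du.
  by rewrite e_sym und.
apply/forall_inP => z zR; apply/implyP => zw; have [zS nvz] := R_P zR.
have za : z != a by apply: contraNneq nvz => ->; move: aA; rewrite inE => /andP[].
have [zD|/dom/(_ zw)[y yD zy]] := boolP (z \in D).
  by have := all z; rewrite inE zD zS (negPf za) du => /(_ isT) /= ->.
have := cl zS zy; rewrite !inE => /orP[/eqP yv|yS].
  by rewrite -yv e_sym zy in nvz.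
have := all y; rewrite inE yD yS => /(_ isT)/orP[]/eqP yE.
  by rewrite [e a z]e_sym -yE zy !orbT.
by rewrite [e u z]e_sym -du -yE zy !orbT.
Qed.

(** A witness containing neither vertex would be connected dominating already. One containing both
    would meet [S] in nothing else, and neither is adjacent to [v]. So it contains exactly one, and
    the other has no old neighbour in it. *)
Lemma end_arrow : {in R &, forall u w, u != w -> ~~ e u w -> arrow e A R u w || arrow e A R w u}.
Proof.
move=> u w uR wR uw nuw.
have [D [cD Dk vD crit]] := local_crit sS (RS uR) (RS wR) uw nuw.
have D2 : #|D :&: S| <= 2 by have := crit _ gX0; lia.
have ncds : ~ connected_dominating e D by move/kmin; rewrite leqNgt Dk.
have main p q : connected_dominating (add_edge e p q) D -> p \in R -> q \in R ->
    p \in D -> q \notin D -> arrow e A R p q.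
  move=> cDpq pR qR pD qD; have [cDe dom] := add_cds1 cDpq pD qD.
  apply: (end_arrow1 cDe vD D2 pR qR pD dom) => y yD; apply: contra_notN ncds => qy.
  apply/andP; split=> //; apply/domP => x xD.
  by have [->|xq] := eqVneq x q; [exists y | apply: dom].
have [uD|uD] := boolP (u \in D); have [wD|wD] := boolP (w \in D).
- exfalso; have [uS nvu] := R_P uR; have [wS nvw] := R_P wR.
  have /andP[_ cDa] := cD.
  have [|z zDS all] := card_le2 D2 (a := u); first by rewrite inE uD.
  have all' y : y \in D -> y \in S -> (y == u) || (y == w).
    move=> yD yS; have := all w; rewrite inE wD wS eq_sym (negPf uw) /= => /(_ isT)/eqP ->.
    by apply: all; rewrite inE yD.
  suff : (u != u) && (u != w) by rewrite eqxx.
  apply: (conn_ind (Pr := fun z => (z != u) && (z != w)) cDa vD uD).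
    by apply/andP; split; [apply: contraNneq vS => -> | apply: contraNneq vS => ->].
  move=> p q pD qD /add_edgeP[pq|[-> _]|[-> _]]; rewrite ?eqxx ?andbF // => /andP[pu pw].
  rewrite -negb_or; apply/negP => qE.
  have [qS nvq] : q \in S /\ ~~ e v q by case/orP: qE => /eqP->.
  have := cl' qS pq; case: eqP => [pv|_ /= pS]; first by rewrite -pv pq in nvq.
  by have := all' p pD pS; rewrite (negPf pu) (negPf pw).
- by rewrite (main u w).
- by rewrite orbC (main w u) // (add_edge_swap e w u).
- by case: ncds; apply: add_cds cD uD wD.
Qed.

(** The second outcome is [x] in the witness [D], whose trace on [S] is then [x] and [d]. The first
    is [x] outside [D], where no vertex of [D] is adjacent to [x], as otherwise [D] would be
    connected dominating already. *)
Lemma end_dom x z0 : x \in R -> z0 \in R -> z0 != x ->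
  (exists a d, [/\ [/\ a \in A, d \in A :|: R, ~~ e a x & ~~ e d x],
       d \in R -> e a d
     & {in R, forall z, z != x -> [|| z == d, e a z | e d z]}]) \/
  (exists2 d, d \in A :|: R & {in R, forall z, [|| z == x, z == d, e x z | e d z]}).
Proof.
move=> xR z0R zx; have [xS nvx] := R_P xR.
have vx : v != x by apply: contraNneq vS => ->.
have [D [cD Dk vD crit]] := local_crit sS (setU11 v S) (RS xR) vx nvx.
have D2 : #|D :&: S| <= 2 by have := crit _ gX0; lia.
have AR_S y : (y \in A :|: R) = (y \in S) by rewrite !inE; case: (y \in S) (e v y) => [] [].
have ncds : ~ connected_dominating e D by move/kmin; rewrite leqNgt Dk.
have [xD|xD] := boolP (x \in D); [right | left].
  have [|d dDS all] := card_le2 D2 (a := x); first by rewrite inE xD.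
  exists d => [|z zR]; first by rewrite AR_S; case/setIP: dDS.
  have [zS nvz] := R_P zR; have zv : z != v by apply: contraNneq vS => <-.
  have [zD|zD] := boolP (z \in D).
    by have := all z; rewrite inE zD zS => /(_ isT)/orP[]->; rewrite ?orbT.
  have /andP[/domP dom _] := cD; have [y yD] := dom z zD.
  case/add_edgeP=> [zy|[zE]|[zE]]; try by rewrite zE ?eqxx // in zv xD *; rewrite ?xD in zD.
  have := cl zS zy; rewrite !inE => /orP[/eqP yv|yS].
    by rewrite -yv e_sym zy in nvz.
  have := all y; rewrite inE yD yS => /(_ isT)/orP[]/eqP yE.
    by rewrite [e x z]e_sym -yE zy !orbT.
  by rewrite [e d z]e_sym -yE zy !orbT.
have [cDe dom] := add_cds1 cD vD xD.
have und y : y \in D -> ~~ e y x.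
  move=> yD; apply: contra_notN ncds => yx; apply/andP; split=> //; apply/domP => z zD.
  by have [->|zx'] := eqVneq z x; [exists y; rewrite // e_sym | apply: dom].
have toS z : z \in R -> z \notin D -> z != x -> exists2 y, y \in D :&: S & e z y.
  move=> zR zD zx'; have [zS nvz] := R_P zR; have [y yD zy] := dom z zD zx'.
  exists y => //; rewrite inE yD; have := cl zS zy; rewrite !inE => /orP[/eqP yv|//].
  by rewrite -yv e_sym zy in nvz.
(* The trace is non-empty because [z0], not being adjacent to [v], lies in it or is dominated from
   it. *)
have [y yDS] : exists y, y \in D :&: S.
  have [zD|zD] := boolP (z0 \in D); first by exists z0; rewrite inE zD; case: (R_P z0R).
  by have [y yDS _] := toS z0 z0R zD zx; exists y.
have [a [d [aDA dDS all ad]]] := small_conn cDe vD D2 yDS.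
have [aD aA] := setIP aDA; have [dD dS] := setIP dDS.
exists a, d; split=> //; first by split; rewrite ?AR_S ?und.
move=> z zR zx'; have [zS nvz] := R_P zR.
have za : z != a by apply: contraNneq nvz => ->; move: aA; rewrite inE => /andP[].
have [zD|zD] := boolP (z \in D).
  by have := all z; rewrite inE zD zS (negPf za) => /(_ isT) /= ->.
have [t tDS zt] := toS z zR zD zx'; have /orP[/eqP tE|/eqP tE] := all t tDS.
  by rewrite [e a z]e_sym -tE zt !orbT.
by rewrite [e d z]e_sym -tE zt !orbT.
Qed.

(** A sole neighbour of [x] would lie in [S], as [x] is not adjacent to [v], and would cut off [x];
    but an end contains no cut vertex. *)
Lemma end_two_nbrs x y : x \in R -> exists z, [/\ z \in A :|: R, z != y & e x z].
Proof.
move=> xR; have [xS nvx] := R_P xR.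
have AR_S z : (z \in A :|: R) = (z \in S) by rewrite !inE; case: (z \in S) (e v z) => [] [].
have xN z : e x z -> z \in S.
  move=> xz; have := cl xS xz; rewrite !inE => /orP[/eqP zv|//].
  by rewrite -zv e_sym xz in nvx.
have [t xt] : exists t, e x t.
  have [[t xt]|no] : (exists t, e x t) \/ forall t, ~~ e x t.
    by case: (pickP (e x)) => [t xt|no]; [left; exists t | right=> t; rewrite no].
    by exists t.
  have : v = x; last by move=> vx; have := vS; rewrite vx xS.
  apply: (@conn_total x _ (fun z => z = x)) => // a b ab ax.
  by rewrite -ax in no; rewrite (negPf (no b)) in ab.
case: (pickP [pred z | (z != y) && e x z]) => [z /andP[zy xz]|no].
  by exists z; rewrite AR_S xN.
have all z : e x z -> z = y.
  by move=> xz; move: (no z); rewrite /= xz andbT => /negbFE/eqP.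
have yS : y \in S by rewrite -(all t) ?xN.
have xy : x != y by apply/eqP => xy; have := xt; rewrite (all t xt) -xy e_irr.
case/negP: (nocut yS); apply/existsP; exists [set x]; apply/and4P; split.
- by apply/set0Pn; exists x; rewrite inE.
- by rewrite inE eq_sym.
- apply/eqP => /setP/(_ v); rewrite !inE => /orP[]/eqP vE.
    by have := vS; rewrite vE yS.
  by have := vS; rewrite vE xS.
apply/forall_inP => _ /set1P->; apply/forallP => z; apply/implyP => /all->.
by rewrite !inE eqxx.
Qed.

Lemma end_edge : R != set0 -> exists a r, [/\ a \in A, r \in R & e a r].
Proof.
case/set0Pn=> r rR.
case: (boolP [exists a in A, exists r in R, e a r]) => [/exists_inP[a aA]|].
  by case/exists_inP=> s sR as_; exists a, s.
move=> no; suff : r \notin R by rewrite rR.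
have vR : v \notin R by rewrite !inE (negPf vS) andbF.
apply: (@conn_total v _ (fun z => z \notin R)) => // a b ab aR.
apply/negP => bR; have [bS nvb] := R_P bR.
have := cl' bS ab; case: eqP => [av|_ /= aS]; first by rewrite -av ab in nvb.
case/negP: no; apply/exists_inP; exists a; last by apply/exists_inP; exists b.
by move: aR; rewrite !inE aS andbT negbK.
Qed.

Lemma end_path : exists p, path e v p /\ perm_eq p (enum S).
Proof.
have AR_S : A :|: R = S.
  by apply/setP => z; rewrite !inE; case: (z \in S) (e v z) => [] [].
have A0 : A != set0.
  apply/eqP => A0; have [[s sS'] _ _ _] := sepP sS.
  suff : s \notin S by rewrite sS'.
  apply: (@conn_total v _ (fun z => z \notin S)) => // a b ab aS.
  apply/negP => bS; have := cl' bS ab; rewrite (negPf aS) orbF => /eqP av.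
  by have := in_set0 b; rewrite -A0 inE bS -av ab.
have [||a [Z [aA pZ pq]]] := @hub_hamilton T e A R e_sym e_irr _ _ end_arrow end_dom
    end_two_nbrs end_edge A0.
- move=> a b; rewrite !inE => /andP[aS va] /andP[bS vb] ab.
  exact: sep_clique sS aS bS va vb ab.
- by move=> a aA; rewrite inE aA.
exists (a :: Z); rewrite -AR_S; split=> //=; rewrite pZ andbT.
by move: aA; rewrite inE => /andP[].
Qed.

End EndBlock.

End Critical.

(** * Two sides that are almost complete *)

Section Small.

Variables (T : finType) (e : rel T) (k : nat).
Hypotheses (e_sym : symmetric e) (e_irr : irreflexive e) (conn : connected_graph e).
Hypothesis kmin : forall S, connected_dominating e S -> k <= #|S|.
Hypothesis kadd : forall u w, u != w -> ~~ e u w ->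
  exists2 S, connected_dominating (add_edge e u w) S & #|S| < k.

Implicit Types (S D X Y Q : {set T}) (u v w x y z : T).

(* [x] is the only possible non-neighbour of [v] in [S], and [Y] has at most one vertex, none if
   [x] is adjacent to [v]. *)
Definition small v S x Y := [/\ sep e v S, x \in S,
  forall y, y \in S -> y != x -> e v y, good e v S Y & #|Y| <= ~~ e v x].

(** If two vertices of [S] were not adjacent to [v], an edge from [v] to one of them would have a
    witness with empty trace on [S], leaving the other undominated. A common neighbour of [v] and
    the only far vertex then serves as trace. *)
Lemma smallI v S X : sep e v S -> good e v S X -> #|X| <= 1 -> exists x Y, small v S x Y.
Proof.
move=> s gX X1; have [[s0 s0S] vS _ cl] := sepP s.
have uniq_far u w : u \in S -> w \in S -> ~~ e v u -> ~~ e v w -> u = w.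
  move=> uS wS nu nw; apply/eqP; apply: contraT => uw.
  have vu : v != u by apply: contraNneq vS => ->.
  have [|D [cD Dk vD crit]] := local_crit e_sym conn kmin kadd s (setU11 v S) _ vu nu.
    by rewrite !inE uS orbT.
  have D0 : D :&: S = set0.
    by apply: cards0_eq; move: X1 (crit _ gX); clear; lia.
  have nD z : z \in S -> z \notin D.
    by move=> zS; apply/negP => zD; have := in_set0 z; rewrite -D0 inE zD zS.
  have /andP[/domP dom _] := cD; have [y yD] := dom w (nD w wS).
  case/add_edgeP=> [wy|[wv _]|[wu _]]; last 2 first.
  - by rewrite -wv wS in vS.
  - by rewrite wu eqxx in uw.
  have := cl _ _ wS wy; rewrite !inE => /orP[/eqP yv|/nD]; last by rewrite yD.
  by rewrite e_sym -yv wy in nw.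
have [x [xS xP]] : exists x, x \in S /\ forall y, y \in S -> y != x -> e v y.
  case: (pickP [pred z in S | ~~ e v z]) => [x /andP[xS nx]|no].
    exists x; split=> // y yS; apply: contraNT => ny.
    by rewrite (uniq_far y x).
  by exists s0; split=> // y yS _; move: (no y); rewrite /= yS => /negbFE.
exists x; have [vx|nvx] := boolP (e v x).
  exists set0; split; rewrite ?cards0 //; split; first exact: sub0set.
    by rewrite setU0; apply: connected_in_set1.
  move=> y yS _; exists v; first by rewrite !inE eqxx.
  by rewrite e_sym; have [->|yx] := eqVneq y x; last exact: xP.
have [a [aS va ax]] : exists a, [/\ a \in S, e v a & e a x].
  case: (boolP [exists a in S, e v a && e a x]) => [/exists_inP[a aS /andP[va ax]]|no].
    by exists a.
  suff : x != x by rewrite eqxx.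
  apply: (@conn_total _ _ conn v x (fun z => z != x)).
    by apply: contraNneq vS => ->.
  move=> a b ab ax; apply: contraNneq no => bx; rewrite bx in ab.
  have : a \in v |: S by apply: (cl x) => //; rewrite e_sym.
  rewrite !inE => /orP[/eqP av|aS]; first by rewrite av (negPf nvx) in ab.
  by apply/exists_inP; exists a; rewrite // xP.
exists [set a]; split; rewrite ?cards1 ?nvx //; split; first by rewrite sub1set.
  by rewrite setUC; apply: (connected_inU1 (w := v));
    rewrite ?inE // ?setU1E; [exact: connected_in_set1].
move=> y yS ya; have [->|yx] := eqVneq y x.
  by exists a; rewrite ?inE ?eqxx ?orbT // e_sym.
by exists v; rewrite ?inE ?eqxx // e_sym xP.
Qed.

(** Bundled so that one symmetry lemma exchanges the roles of the two sides. *)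
Definition pair_hyp v1 S1 x1 Y1 v2 S2 x2 Y2 D :=
  [/\ small v1 S1 x1 Y1, small v2 S2 x2 Y2, forall z, z \in S1 -> z \notin S2,
      v1 \notin S2 /\ v2 \notin S1 & connected_dominating (add_edge e x1 x2) D].

Lemma pair_hyp_sym v1 S1 x1 Y1 v2 S2 x2 Y2 D :
  pair_hyp v1 S1 x1 Y1 v2 S2 x2 Y2 D -> pair_hyp v2 S2 x2 Y2 v1 S1 x1 Y1 D.
Proof.
case=> sm1 sm2 dis [v12 v21] cD; split=> //; last by rewrite add_edge_swap.
by move=> z; apply: contraL; apply: dis.
Qed.

(** * Two small sides joined by a new edge *)

Section Pair.

Variables (v1 v2 x1 x2 : T) (S1 S2 Y1 Y2 D : {set T}).
Hypothesis ph : pair_hyp v1 S1 x1 Y1 v2 S2 x2 Y2 D.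

Let O := ~: (S1 :|: S2).
Let Q := D :\: (S1 :|: S2).
Let e' := add_edge e x1 x2.
(** The cost of [S1] once [v1] is chosen, the bound on [#|Y1|] in [small]. *)
Let r1 : nat := ~~ e v1 x1.
Let r2 : nat := ~~ e v2 x2.

Let s1 : sep e v1 S1. Proof. by case: ph => -[]. Qed.
Let s2 : sep e v2 S2. Proof. by case: ph => _ []. Qed.
Let x1S : x1 \in S1. Proof. by case: ph => -[]. Qed.
Let x2S : x2 \in S2. Proof. by case: ph => _ []. Qed.
Let dis z : z \in S1 -> z \notin S2. Proof. by case: ph => _ _ + _ _; apply. Qed.
Let dis' z : z \in S2 -> z \notin S1. Proof. by apply: contraL; apply: dis. Qed.
Let v1S1 : v1 \notin S1. Proof. by case/sepP: s1. Qed.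
Let v2S2 : v2 \notin S2. Proof. by case/sepP: s2. Qed.
Let v1S2 : v1 \notin S2. Proof. by case: ph => _ _ _ []. Qed.
Let v2S1 : v2 \notin S1. Proof. by case: ph => _ _ _ []. Qed.
Let v1O : v1 \in O. Proof. by rewrite !inE negb_or v1S1. Qed.
Let v2O : v2 \in O. Proof. by rewrite !inE negb_or v2S1. Qed.
Let e'_sym : symmetric e'. Proof. exact: add_edge_sym. Qed.
Let cD : connected_in e' D. Proof. by case: ph => _ _ _ _ /andP[]. Qed.
Let dom x : x \notin D -> exists2 y, y \in D & e' x y.
Proof. by case: ph => _ _ _ _ /andP[/domP + _]; apply. Qed.

Lemma in_inner z : (z \in Q) = (z \in D) && (z \in O).
Proof. by rewrite !inE andbC. Qed.

Lemma in_outer z : z \in O -> (z \notin S1) /\ (z \notin S2).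
Proof. by rewrite !inE => /norP. Qed.

Lemma regions z : [\/ z \in O, z \in S1 | z \in S2].
Proof.
rewrite !inE; case: (boolP (z \in S1)) => /= zS1; first by constructor 2.
by case: (boolP (z \in S2)) => zS2; [constructor 3 | constructor 1].
Qed.

Lemma side1_adj a b : a \in S1 -> e' a b ->
  [\/ b \in S1, b = v1 /\ e a v1 | a = x1 /\ b = x2].
Proof.
move=> aS /add_edgeP[ab|ab|[ax _]]; [|by constructor 3|].
  have [_ _ _ cl] := sepP s1; have := cl _ _ aS ab; rewrite !inE.
  by case/orP=> [/eqP bv|]; [constructor 2; rewrite -bv | constructor 1].
by have := dis aS; rewrite ax x2S.
Qed.

Lemma side2_adj a b : a \in S2 -> e' a b ->
  [\/ b \in S2, b = v2 /\ e a v2 | a = x2 /\ b = x1].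
Proof.
move=> aS /add_edgeP[ab|[ax _]|ab]; [| |by constructor 3].
  have [_ _ _ cl] := sepP s2; have := cl _ _ aS ab; rewrite !inE.
  by case/orP=> [/eqP bv|]; [constructor 2; rewrite -bv | constructor 1].
by have := dis' aS; rewrite ax x1S.
Qed.

Lemma outer_adj a b : a \in O -> e' a b -> e a b.
Proof.
move=> /in_outer[a1 a2] /add_edgeP[//|[ax]|[ax]]; first by rewrite ax x1S in a1.
by rewrite ax x2S in a2.
Qed.

Lemma outer_side1 a b : a \in O -> b \in S1 -> e' a b -> a = v1 /\ e v1 b.
Proof.
move=> aO bS ab; have [a1 a2] := in_outer aO.
have /(side1_adj bS)[aS|[av bv]|[_ ax]] : e' b a by rewrite e'_sym.
- by rewrite aS in a1.
- by rewrite e_sym.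
- by rewrite ax x2S in a2.
Qed.

Lemma outer_side2 a b : a \in O -> b \in S2 -> e' a b -> a = v2 /\ e v2 b.
Proof.
move=> aO bS ab; have [a1 a2] := in_outer aO.
have /(side2_adj bS)[aS|[av bv]|[_ ax]] : e' b a by rewrite e'_sym.
- by rewrite aS in a2.
- by rewrite e_sym.
- by rewrite ax x1S in a1.
Qed.

Lemma card_D : #|D| = #|Q| + (#|D :&: S1| + #|D :&: S2|).
Proof.
rewrite -(cardsID (S1 :|: S2) D) addnC; congr (_ + _).
rewrite setIUr cardsU; have -> : D :&: S1 :&: (D :&: S2) = set0; last by rewrite cards0 subn0.
apply/setP => z; rewrite !inE; case: (boolP (z \in S1)) => [/dis/negPf->|]; rewrite ?andbF //.
Qed.

(* Adding [Y1] and [Y2] to [X] gives a connected dominating set of the original graph. *)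
Lemma outer_bound X : X \subset O -> v1 \in X -> v2 \in X -> connected_in e X ->
  (forall z, z \in O -> z \notin X -> exists2 y, y \in X & e z y) ->
  k <= #|X| + (r1 + r2).
Proof.
move=> XO v1X v2X cX domX; case: ph => -[_ _ _ [_ cY1 dY1] Y1r] [_ _ _ [_ cY2 dY2] Y2r] _ _ _.
suff cds : connected_dominating e (X :|: (v1 |: Y1) :|: (v2 |: Y2)).
  have := kmin cds; have -> : X :|: (v1 |: Y1) :|: (v2 |: Y2) = X :|: (Y1 :|: Y2).
    by apply/setP => z; rewrite !inE; do 2![case: eqP => [->|_] /=; rewrite ?v1X ?v2X ?orbT //]; rewrite orbA.
  by have [+ _] := leq_card_setU X (Y1 :|: Y2); have [+ _] := leq_card_setU Y1 Y2; move: Y1r Y2r; rewrite -/r1 -/r2; clear; lia.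
apply/andP; split; last first.
  apply: (connected_inU (v := v2)); rewrite ?inE ?v2X ?eqxx //.
  by apply: (connected_inU (v := v1)); rewrite ?inE ?v1X ?eqxx.
apply/domP => z; rewrite !in_setU !negb_or => /andP[/andP[zX /andP[_ zY1]] /andP[_ zY2]].
have [zO|zS|zS] := regions z.
- by have [y yX zy] := domX z zO zX; exists y => //; rewrite !in_setU yX.
- by have [y yX zy] := dY1 z zS zY1; exists y; rewrite // in_setU in_setU yX orbT.
- by have [y yX zy] := dY2 z zS zY2; exists y; rewrite // in_setU yX orbT.
Qed.

(** Collapsing [S1] to [v1] and then [S2] to [v2] retracts the graph onto [O]. *)
Lemma connO : connected_in e O.
Proof.
have c1 : connected_in e ([set: T] :&: (v1 |: ~: (v1 |: S1))).
  apply: connected_in_retract; rewrite ?inE // => x y _ xS _.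
  by have [_ _ _ cl] := sepP (sepC e_sym s1); apply: cl.
have E : [set: T] :&: (v1 |: ~: (v1 |: S1)) = ~: S1.
  by apply/setP => z; rewrite !inE; case: eqP => [->|//]; rewrite v1S1.
have c2 : connected_in e (~: S1 :&: (v2 |: ~: (v2 |: S2))).
  apply: connected_in_retract; rewrite -?E // ?E ?inE // => x y _ xS _.
  by have [_ _ _ cl] := sepP (sepC e_sym s2); apply: cl.
have -> // : O = ~: S1 :&: (v2 |: ~: (v2 |: S2)).
apply/setP => z; rewrite !inE negb_or; case: eqP => [->|//].
by rewrite v2S2.
Qed.

(** Among outer vertices only [v1] and [v2] have neighbours inside the sides; the others are
    dominated by [Q]. *)
Lemma Q_dom z : z \in O -> z \notin Q -> (z = v1 -> v1 \in D) -> z != v2 \/ v2 \in D ->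
  exists2 y, y \in Q & e z y.
Proof.
move=> zO zQ h1 h2; have zD : z \notin D by move: zQ; rewrite in_inner zO andbT.
have [y yD zy] := dom zD; have [yO|yS|yS] := regions y.
- by exists y; [rewrite in_inner yD | apply: outer_adj].
- by have [zv _] := outer_side1 zO yS zy; rewrite zv h1 in zD.
- have [zv _] := outer_side2 zO yS zy; case: h2; first by rewrite zv eqxx.
  by rewrite -zv (negPf zD).
Qed.

Lemma card_ge2 (X : {set T}) a b : a \in X -> b \in X -> a != b -> 2 <= #|X|.
Proof. by move=> aX bX ab; apply/card_gt1P; exists a, b. Qed.

Lemma card_ge1 (X : {set T}) a : a \in X -> 1 <= #|X|.
Proof. by move=> aX; apply/card_gt0P; exists a. Qed.

(** Only [x2] can dominate [x1], so it lies in [D]; if it is not adjacent to [v2], a further vertex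
    of [S2] attaches it. *)
Lemma pair_half : v2 \in D -> ~~ e v1 x1 -> D :&: S1 = set0 -> 1 + r2 <= #|D :&: S2|.
Proof.
move=> v2D n1 D0.
have nD z : z \in S1 -> z \notin D.
  by move=> zS; apply/negP => zD; have := in_set0 z; rewrite -D0 inE zD zS.
have [y yD] := dom (nD _ x1S).
case/(side1_adj x1S)=> [/nD|[_]|[_ yx]]; first by rewrite yD.
  by rewrite e_sym (negPf n1).
rewrite yx in yD; rewrite /r2; have [_|n2] /= := boolP (e v2 x2).
  by apply: (@card_ge1 _ x2); rewrite inE yD.
have [/existsP[b /and3P[bD bS bx]]|/existsP no] :=
    boolP [exists b, [&& b \in D, b \in S2 & b != x2]].
  by apply: (@card_ge2 _ x2 b); rewrite ?inE ?yD ?bD // eq_sym.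
exfalso; suff : v2 = x2 by move=> vx; have := v2S2; rewrite vx x2S.
apply: (conn_ind (Pr := fun z => z = x2) cD yD v2D) => // a b aD bD ab ax; rewrite ax in ab.
case: (side2_adj x2S ab) => [bS|[_]|[_ bx]].
- by apply/eqP; apply: contraT => bx; case: no; exists b; rewrite bD bS.
- by rewrite e_sym (negPf n2).
- by have := nD _ x1S; rewrite -bx bD.
Qed.

(** [D] can connect [v1] to [v2] only by running through the new edge, so it contains [x1] and, if
    [x1] is not adjacent to [v1], another vertex of [S1] on the way. *)
Lemma pair_cross : v1 \in D -> v2 \in D -> ~~ connect (induced e Q) v1 v2 ->
  1 + r1 <= #|D :&: S1|.
Proof.
move=> v1D v2D nc.
have stepQ a b : a \in D -> a \in O -> b \in D -> b \in O -> e' a b ->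
    connect (induced e Q) v1 a -> connect (induced e Q) v1 b.
  by move=> aD aO bD bO ab ca; apply: connect_stepI ca _ _ (outer_adj aO ab); rewrite in_inner ?aD ?bD.
have x1D : x1 \in D.
  apply: contraT => x1D.
  have [] : (v2 \in O -> connect (induced e Q) v1 v2) /\ v2 \notin S2; last first.
    by move=> /(_ v2O); rewrite (negPf nc).
  apply: (conn_ind (Pr := fun z => (z \in O -> connect (induced e Q) v1 z) /\ z \notin S2)
    cD v1D v2D) => // a b aD bD ab [ca aS2].
  have bS2 : b \notin S2.
    apply/negP => bS; have [aO|aS|] := regions a; last by rewrite (negPf aS2).
      by have [av _] := outer_side2 aO bS ab; move: (ca aO); rewrite av (negPf nc).
    case: (side1_adj aS ab) => [bS1|[bv _]|[ax _]].
    - by have := dis bS1; rewrite bS.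
    - by have := v1S2; rewrite -bv bS.
    - by rewrite -ax aD in x1D.
  split=> // bO; have [aO|aS|] := regions a; last by rewrite (negPf aS2).
    exact: stepQ ab (ca aO).
  case: (side1_adj aS ab) => [bS1|[-> _]|[_ bx]]; last by rewrite bx x2S in bS2.
    by have [] := in_outer bO; rewrite bS1.
  exact: connect0.
rewrite /r1; have [_|n1] /= := boolP (e v1 x1).
  by apply: (@card_ge1 _ x1); rewrite inE x1D.
have [/existsP[b /and3P[bD bS bx]]|/existsP no] :=
    boolP [exists b, [&& b \in D, b \in S1 & b != x1]].
  by apply: (@card_ge2 _ x1 b); rewrite ?inE ?x1D ?bD // eq_sym.
have [] : v2 \in O /\ connect (induced e Q) v1 v2; last by rewrite (negPf nc).
apply: (conn_ind (Pr := fun z => z \in O /\ connect (induced e Q) v1 z) cD v1D v2D).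
  by split=> //; apply: connect0.
move=> a b aD bD ab [aO ca]; have [bO|bS|bS] := regions b.
- by split=> //; apply: stepQ ab ca.
- have [av vb] := outer_side1 aO bS ab; have [bx|bx] := eqVneq b x1.
    by rewrite bx (negPf n1) in vb.
  by case: no; exists b; rewrite bD bS.
- by have [av vb] := outer_side2 aO bS ab; rewrite av (negPf nc) in ca.
Qed.

(** Without [v2], only the new edge links [S2] to the rest of [D]. So [x1] is in [D], and [S1]
    carries one vertex more than its cost [r1]; this surplus pays for adding [v2] to [Q]. *)
Lemma pair_one_side : v1 \in D -> v2 \notin D -> k <= #|D|.
Proof.
move=> v1D v2D.
have cQ : connected_in e Q.
  apply: (connected_inI (x := v1)); rewrite ?in_inner ?v1D // => q; rewrite in_inner => /andP[qD qO].
  move: qO; apply: (conn_ind (Pr := fun z => z \in O -> connect (induced e Q) v1 z) cD v1D qD).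
    by move=> _; apply: connect0.
  move=> a b aD bD ab ca bO; have [b1 b2] := in_outer bO; have [aO|aS|aS] := regions a.
  - by apply: connect_stepI (ca aO) _ _ (outer_adj aO ab); rewrite in_inner ?aD ?bD.
  - case: (side1_adj aS ab) => [bS1|[-> _]|[_ bx]]; [by rewrite bS1 in b1| exact: connect0|].
    by rewrite bx x2S in b2.
  - case: (side2_adj aS ab) => [bS1|[bv _]|[_ bx]]; first by rewrite bS1 in b2.
      by rewrite -bv bD in v2D.
    by rewrite bx x1S in b1.
have Qd z : z \in O -> z \notin Q -> z != v2 -> exists2 y, y \in Q & e z y.
  by move=> zO zQ zv; apply: Q_dom => //; left.
have v1Q : v1 \in Q by rewrite in_inner v1D.
have into2 z : z \in D -> z \in S2 -> x1 \in D /\ x2 \in D.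
  move=> zD zS; apply/andP; apply: contraT => nx.
  suff : v1 \in S2 by rewrite (negPf v1S2).
  apply: (conn_ind (Pr := fun z => z \in S2) cD zD v1D) => // a b aD bD ab aS.
  case: (side2_adj aS ab) => [//|[bv _]|[ax bx]]; first by rewrite -bv bD in v2D.
  by rewrite -ax -bx aD bD in nx.
have x1D : x1 \in D.
  have [x2D|x2D] := boolP (x2 \in D); first by case: (into2 _ x2D x2S).
  have [y yD] := dom x2D; case/(side2_adj x2S)=> [yS|[yv _]|[_ yx]].
  - by case: (into2 _ yD yS).
  - by rewrite -yv yD in v2D.
  - by rewrite -yx.
have D1 : 1 + r1 <= #|D :&: S1|.
  rewrite /r1; have [_|n1] /= := boolP (e v1 x1).
    by apply: (@card_ge1 _ x1); rewrite inE x1D.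
  have [/existsP[b /and3P[bD bS bx]]|/existsP no] :=
      boolP [exists b, [&& b \in D, b \in S1 & b != x1]].
    by apply: (@card_ge2 _ x1 b); rewrite ?inE ?x1D ?bD // eq_sym.
  have : x1 \in O; last by case/in_outer; rewrite x1S.
  apply: (conn_ind (Pr := fun z => z \in O) cD v1D x1D) => // a b aD bD ab aO.
  have [//|bS|bS] := regions b.
    have [av vb] := outer_side1 aO bS ab; have [bx|bx] := eqVneq b x1.
      by rewrite bx (negPf n1) in vb.
    by case: no; exists b; rewrite bD bS.
  by have [av _] := outer_side2 aO bS ab; rewrite -av aD in v2D.
have [w wD /(outer_adj v2O) vw] := dom v2D.
have QO : Q \subset O by apply/subsetP => z; rewrite in_inner => /andP[].
have v2Q z : z \notin v2 |: Q -> z \notin Q /\ z != v2.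
  by rewrite !in_setU1 negb_or => /andP[].
rewrite card_D; have [wO|wS|wS] := regions w.
- have wQ : w \in Q by rewrite in_inner wD.
  have := @outer_bound (v2 |: Q); rewrite subUset sub1set v2O QO setU11 !in_setU1 v1Q orbT.
  rewrite (connected_inU1 e_sym cQ wQ) 1?e_sym //.
  have D2 : r2 <= #|D :&: S2|.
    rewrite /r2; have [//|n2] /= := boolP (e v2 x2).
    have [/existsP[b /andP[bD bS]]|/existsP no] := boolP [exists b, (b \in D) && (b \in S2)].
      by apply: (@card_ge1 _ b); rewrite inE bD.
    (* As [x2] is not adjacent to [v2], it is attached to it through a second vertex [a] of [S2].
       With [v2] outside [D], only a vertex of [S2] can dominate [a]. *)
    have [a aS ax] : exists2 a, a \in S2 & a != x2.
      case: ph => _ [_ _ _ [Y2S cY2 dY2] _] _ _ _.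
      have [x2Y|x2Y] := boolP (x2 \in Y2).
        have v2v : v2 \in v2 |: Y2 by rewrite !inE eqxx.
        have x2v : x2 \in v2 |: Y2 by rewrite !inE x2Y orbT.
        apply/exists_inP; apply: contraT => /exists_inP no2.
        suff : x2 = v2 by move=> xv; have := v2S2; rewrite -xv x2S.
        apply: (conn_ind (Pr := fun z => z = v2) cY2 v2v x2v) => // a b _ bv ab av.
        move: bv; rewrite !inE => /orP[/eqP//|/(subsetP Y2S) bS].
        have [bx|bx] := eqVneq b x2; first by rewrite -av -bx ab in n2.
        by case: no2; exists b.
      have [y yY x2y] := dY2 _ x2S x2Y; exists y.
        move: yY; rewrite !inE => /orP[/eqP yv|/(subsetP Y2S)//].
        by rewrite -yv e_sym x2y in n2.
      by apply: contraTneq x2y => ->; rewrite e_irr.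
    have aD : a \notin D by apply/negP => aD; case: no; exists a; rewrite aD.
    have [y yD] := dom aD; case/(side2_adj aS)=> [yS|[yv _]|[ax' _]].
    - by case: no; exists y; rewrite yD.
    - by rewrite -yv yD in v2D.
    - by rewrite ax' eqxx in ax.
  move=> /(_ isT isT isT isT) bd; have {bd} : k <= #|v2 |: Q| + (r1 + r2).
    by apply: bd => z zO /v2Q[zQ zv]; have [y yQ zy] := Qd z zO zQ zv; exists y; rewrite ?in_setU1 ?yQ ?orbT.
  by rewrite cardsU1; move: D1 D2; case: (v2 \notin Q) => /=; clear; lia.
- by have [vv _] := outer_side1 v2O wS (add_edge_old _ _ vw); rewrite vv v1D in v2D.
have [_ x2D] := into2 _ wD wS.
have D2 : 1 + r2 <= #|D :&: S2|.
  rewrite /r2; have [_|n2] /= := boolP (e v2 x2).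
    by apply: (@card_ge1 _ x2); rewrite inE x2D.
  apply: (@card_ge2 _ x2 w); rewrite ?inE ?x2D ?wD //.
  by apply: contraNneq n2 => ->.
(* [v2] may have no neighbour in [Q]. A neighbour [t] in [O] connects it, and one surplus vertex on
   each side pays for [v2] and [t]. *)
have [t tO tv] : exists2 t, t \in O & e t v2.
  case: (boolP [exists t in O, e t v2]) => [/exists_inP//|/exists_inP no].
  suff : v2 != v2 by rewrite eqxx.
  apply: (conn_ind (Pr := fun z => z != v2) connO v1O v2O).
    by apply: contraNneq v2D => <-.
  by move=> a b aO bO ab _; apply/eqP => bv; case: no; exists a; rewrite // -bv.
have tv2 : t != v2 by apply: contraTneq tv => ->; rewrite e_irr.
have ctQ : connected_in e (t |: Q).
  have [tQ|tQ] := boolP (t \in Q); first by rewrite (setUidPr _) ?sub1set.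
  by have [y yQ ty] := Qd t tO tQ tv2; apply: (connected_inU1 (w := y)); rewrite // e_sym.
have : k <= #|v2 |: (t |: Q)| + (r1 + r2).
  apply: outer_bound.
  - by rewrite !subUset !sub1set v2O tO QO.
  - by rewrite !in_setU1 v1Q !orbT.
  - exact: setU11.
  - by apply: (connected_inU1 (w := t)); rewrite // setU11.
  move=> z zO; rewrite !in_setU1 !negb_or => /and3P[zv _ zQ].
  by have [y yQ zy] := Qd z zO zQ zv; exists y; rewrite // !in_setU1 yQ !orbT.
by rewrite !cardsU1; move: D1 D2; case: (v2 \notin _) (t \notin _) => [] [] /=; clear; lia.
Qed.

(** [D] cannot enter [O], so [O] consists of [v1] and [v2] and [outer_bound] gives at most four.
    With [4 <= k] all estimates are tight: both sides cost one vertex, and [D] has two vertices on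
    each. *)
Lemma pair_neither : 4 <= k -> v1 \notin D -> v2 \notin D -> k <= #|D|.
Proof.
move=> k4 v1D v2D.
have DO z : z \in D -> z \notin O.
  move=> zD; apply/negP => zO.
  have DO y : y \in D -> y \in O.
    move=> yD; apply: (conn_ind (Pr := fun z => z \in O) cD zD yD) => // a b aD bD ab aO.
    have [//|bS|bS] := regions b.
      by have [av _] := outer_side1 aO bS ab; rewrite -av aD in v1D.
    by have [av _] := outer_side2 aO bS ab; rewrite -av aD in v2D.
  have x1D : x1 \notin D by apply/negP => /DO/in_outer[]; rewrite x1S.
  have [y yD] := dom x1D; have [y1 y2] := in_outer (DO _ yD).
  case/(side1_adj x1S) => [yS|[yv _]|[_ yx]]; first by rewrite yS in y1.
    by rewrite -yv yD in v1D.
  by rewrite yx x2S in y2.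
have Ov z : z \in O -> (z == v1) || (z == v2).
  move=> zO; have zD : z \notin D by apply: contraL zO; apply: DO.
  have [y yD zy] := dom zD; have [yO|yS|yS] := regions y; first by have := DO _ yD; rewrite yO.
    by have [-> _] := outer_side1 zO yS zy; rewrite eqxx.
  by have [-> _] := outer_side2 zO yS zy; rewrite eqxx orbT.
have := outer_bound (subxx O) v1O v2O connO.
have OE : O = [set v1; v2].
  apply/setP => z; rewrite in_set2; apply/idP/idP; first exact: Ov.
  by case/orP=> /eqP->.
move=> /(_ (fun z zO => ltac:(by rewrite zO))); rewrite OE cards2.
move=> bd; have [v12 n1 n2] : [/\ v1 != v2, ~~ e v1 x1 & ~~ e v2 x2].
  by move: bd k4; rewrite /r1 /r2; case: (v1 != v2) (e v1 x1) (e v2 x2) => [] [] [] //=; clear; lia.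
have [y1 y1D /(outer_adj v1O) vy1] := dom v1D; have [y2 y2D /(outer_adj v2O) vy2] := dom v2D.
have y1S : y1 \in S1.
  have [yO|//|yS] := regions y1; first by have := DO _ y1D; rewrite yO.
  by have [vv _] := outer_side2 v1O yS (add_edge_old _ _ vy1); rewrite vv eqxx in v12.
have y2S : y2 \in S2.
  have [yO|yS|//] := regions y2; first by have := DO _ y2D; rewrite yO.
  by have [vv _] := outer_side1 v2O yS (add_edge_old _ _ vy2); rewrite vv eqxx in v12.
have /andP[x1D x2D] : (x1 \in D) && (x2 \in D).
  apply: contraT => nx; suff : y2 \in S1 by rewrite (negPf (dis' y2S)).
  apply: (conn_ind (Pr := fun z => z \in S1) cD y1D y2D) => // a b aD bD ab aS.
  case: (side1_adj aS ab) => [//|[bv _]|[ax bx]]; first by rewrite -bv bD in v1D.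
  by rewrite -ax -bx aD bD in nx.
have D1 : 2 <= #|D :&: S1|.
  apply: (@card_ge2 _ x1 y1); rewrite ?inE ?x1D ?y1D //.
  by apply: contraNneq n1 => ->.
have D2 : 2 <= #|D :&: S2|.
  apply: (@card_ge2 _ x2 y2); rewrite ?inE ?x2D ?y2D //.
  by apply: contraNneq n2 => ->.
by move: bd D1 D2; rewrite card_D /r1 /r2 v12 n1 n2; clear; lia.
Qed.

(* [Q] has two components and dominates [O], so two more vertices connect it. *)
Lemma bridge : v1 \in D -> v2 \in D -> ~~ connect (induced e Q) v1 v2 ->
  k <= #|Q| + 2 + (r1 + r2).
Proof.
move=> v1D v2D nc.
have QO : Q \subset O by apply/subsetP => z; rewrite in_inner => /andP[].
have v1Q : v1 \in Q by rewrite in_inner v1D.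
have v2Q : v2 \in Q by rewrite in_inner v2D.
have Qsym := sym_connect_sym (induced_sym Q e_sym).
have Qd z : z \in O -> z \notin Q -> exists2 y, y \in Q & e z y.
  by move=> zO zQ; apply: Q_dom => //; right.
have reach q : q \in Q -> connect (induced e Q) v1 q || connect (induced e Q) v2 q.
  rewrite in_inner => /andP[qD]; apply: (conn_ind (Pr := fun z => z \in O ->
    connect (induced e Q) v1 z || connect (induced e Q) v2 z) cD v1D qD).
    by move=> _; rewrite connect0.
  move=> a b aD bD ab ca bO; have [b1 b2] := in_outer bO; have [aO|aS|aS] := regions a.
  - have aQ : a \in Q by rewrite in_inner aD.
    have bQ : b \in Q by rewrite in_inner bD.
    by case/orP: (ca aO) => c; apply/orP; [left | right]; apply: connect_stepI c _ _ (outer_adj aO ab).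
  - case: (side1_adj aS ab) => [bS1|[-> _]|[_ bx]]; [by rewrite bS1 in b1| by rewrite connect0|].
    by rewrite bx x2S in b2.
  - case: (side2_adj aS ab) => [bS1|[-> _]|[_ bx]]; [by rewrite bS1 in b2| by rewrite connect0 orbT|].
    by rewrite bx x1S in b1.
(* The closed neighbourhood of the component of [v1] in [Q]. An edge [ab] of [O] leaving it ends in
   a vertex that belongs to the component of [v2] or is dominated by it. *)
pose near z := [exists q in Q, connect (induced e Q) v1 q && ((q == z) || e q z)].
have [a [b [aO bO na nb ab]]] : exists a b, [/\ a \in O, b \in O, near a, ~~ near b & e a b].
  case: (boolP [exists a in O, exists b in O, [&& near a, ~~ near b & e a b]]).
    by case/exists_inP=> a aO /exists_inP[b bO /and3P[]]; exists a, b.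
  move=> /exists_inP no; suff : near v2.
    case/exists_inP=> q qQ /andP[cq /orP[/eqP qv|qv]]; first by rewrite -qv cq in nc.
    by rewrite (connect_stepI cq qQ v2Q qv) in nc.
  apply: (conn_ind (Pr := fun z => near z) connO v1O v2O).
    by apply/exists_inP; exists v1; rewrite // connect0 eqxx.
  move=> a b aO bO ab na; apply: contraT => nb; case: no; exists a => //.
  by apply/exists_inP; exists b; rewrite // na nb.
pose X := b |: (a |: Q).
have QX : Q \subset X by apply/subsetP => z zQ; rewrite !in_setU1 zQ !orbT.
have aX : a \in X by rewrite !in_setU1 eqxx orbT.
have bX : b \in X by rewrite !in_setU1 eqxx.
have up x y : connect (induced e Q) x y -> connect (induced e X) x y.
  by apply: connect_mono => //.
have ca : connect (induced e X) v1 a.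
  case/exists_inP: na => q qQ /andP[/up cq /orP[/eqP<-//|qa]].
  by apply: connect_stepI cq _ aX qa; apply: (subsetP QX).
have cb : connect (induced e X) v1 b by apply: connect_stepI ca aX bX ab.
have far q : q \in Q -> ~~ connect (induced e Q) v1 q -> connect (induced e Q) q v2.
  by move=> qQ nq; rewrite Qsym; have := reach q qQ; rewrite (negPf nq).
have c2 : connect (induced e X) v1 v2.
  have [bQ|bQ] := boolP (b \in Q).
    apply: connect_trans cb _; apply: up; apply: far => //.
    by apply: contra nb => cb'; apply/exists_inP; exists b; rewrite // cb' eqxx.
  have [q qQ bq] := Qd b bO bQ.
  apply: (@connect_trans _ _ q); first by apply: connect_stepI cb bX _ bq; apply: (subsetP QX).
  apply: up; apply: far => //; apply: contra nb => cq.
  by apply/exists_inP; exists q; rewrite // cq [e q b]e_sym bq orbT.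
have : k <= #|X| + (r1 + r2).
  apply: outer_bound.
  - by rewrite !subUset !sub1set aO bO QO.
  - exact: (subsetP QX).
  - exact: (subsetP QX).
  - apply: (connected_inI (x := v1)); rewrite ?(subsetP QX) // => z.
    rewrite !in_setU1 => /predU1P[->//|/predU1P[->//|/reach/orP[/up//|/up]]].
    exact: connect_trans.
  move=> z zO zX; have [|y yQ zy] := Qd z zO; first by apply: contra zX => /(subsetP QX).
  by exists y => //; apply: (subsetP QX).
by rewrite /X !cardsU1; case: (b \notin _) (a \notin _) => [] [] /=; clear; lia.
Qed.

Lemma pair_connected : v1 \in D -> connect (induced e Q) v1 v2 ->
  k <= #|Q| + (r1 + r2).
Proof.
move=> v1D c12.
have v2D : v2 \in D.
  have [<-//|v12] := eqVneq v1 v2.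
  case/connectP: c12 => p; case/lastP: p => [|p z] /=; first by move=> _ vv; rewrite vv eqxx in v12.
  rewrite last_rcons rcons_path => /andP[_ /and3P[_ zQ _]] vz.
  by move: zQ; rewrite -vz in_inner => /andP[].
have QO : Q \subset O by apply/subsetP => z; rewrite in_inner => /andP[].
have v1Q : v1 \in Q by rewrite in_inner v1D.
have v2Q : v2 \in Q by rewrite in_inner v2D.
apply: outer_bound => //; last by move=> z zO zQ; apply: Q_dom => //; right.
apply: (connected_inI (x := v1)) => // q; rewrite in_inner => /andP[qD].
apply: (conn_ind (Pr := fun z => z \in O -> connect (induced e Q) v1 z) cD v1D qD).
  by move=> _; apply: connect0.
move=> a b aD bD ab ca bO; have [b1 b2] := in_outer bO; have [aO|aS|aS] := regions a.
- by apply: connect_stepI (ca aO) _ _ (outer_adj aO ab); rewrite in_inner ?aD ?bD.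
- case: (side1_adj aS ab) => [bS1|[-> _]|[_ bx]]; [by rewrite bS1 in b1| exact: connect0|].
  by rewrite bx x2S in b2.
- case: (side2_adj aS ab) => [bS1|[-> _]|[_ bx]]; [by rewrite bS1 in b2| exact: c12|].
  by rewrite bx x1S in b1.
Qed.

End Pair.

(* The set [D] witnessing criticality at [x1 x2] would have to save a vertex by running through the
   new edge, but a run from [v1] to [v2] through both sides uses up what it saves. *)
Lemma no_pair v1 S1 X1 v2 S2 X2 : 4 <= k -> sep e v1 S1 -> sep e v2 S2 ->
  (forall z, z \in S1 -> z \notin S2) -> v1 \notin S2 -> v2 \notin S1 ->
  good e v1 S1 X1 -> good e v2 S2 X2 -> #|X1| <= 1 -> 2 <= #|X2|.
Proof.
move=> k4 s1 s2 dis v12 v21 g1 g2 X11; rewrite ltnNge; apply/negP => X21.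
have [x1 [Y1 sm1]] := smallI s1 g1 X11; have [x2 [Y2 sm2]] := smallI s2 g2 X21.
have [x1S x2S] : x1 \in S1 /\ x2 \in S2 by case: sm1 sm2 => _ ? _ _ _ [].
have x12 : x1 != x2 by apply: contraNneq (dis _ x1S) => ->.
have n12 : ~~ e x1 x2.
  apply/negP => x12e; have [_ _ _ cl] := sepP s1.
  have := cl _ _ x1S x12e; rewrite !inE => /orP[/eqP xv|xS]; first by rewrite -xv x2S in v12.
  by have := dis _ xS; rewrite x2S.
have [D cD] := kadd x12 n12; rewrite ltnNge => /negP; apply.
have ph : pair_hyp v1 S1 x1 Y1 v2 S2 x2 Y2 D by split.
have hp := pair_hyp_sym ph.
have [v1D|v1D] := boolP (v1 \in D); have [v2D|v2D] := boolP (v2 \in D); last 3 first.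
- exact: pair_one_side ph v1D v2D.
- exact: pair_one_side hp v2D v1D.
- exact: pair_neither ph k4 v1D v2D.
rewrite (card_D ph).
have [c12|nc] := boolP (connect (induced e (D :\: (S1 :|: S2))) v1 v2).
  have := pair_connected ph v1D c12.
  (* The traces of [D] on the sides must have at least [~~ e v1 x1 + ~~ e v2 x2] vertices in total.
     Non-empty traces suffice; [pair_half] treats empty ones. *)
  have h1 := pair_half ph v2D; have h2 := pair_half hp v1D.
  have [D1|D1] := eqVneq (D :&: S1) set0.
    have := h1^~ D1; case: (e v1 x1) => /=; last by move/(_ isT); (clear; lia).
    rewrite D1 cards0; have [D2|] := eqVneq (D :&: S2) set0.
      by have := h2^~ D2; rewrite D1 cards0; case: (e v2 x2) => //=; [(clear; lia) | move/(_ isT); (clear; lia)].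
    by rewrite -card_gt0; case: (e v2 x2) => /=; (clear; lia).
  have [D2|] := eqVneq (D :&: S2) set0.
    have := h2^~ D2; case: (e v2 x2) => /=; last by move/(_ isT); (clear; lia).
    by move: D1; rewrite D2 cards0 -card_gt0; case: (e v1 x1) => /=; (clear; lia).
  by move: D1; rewrite -!card_gt0; case: (e v1 x1) (e v2 x2) => [] [] /=; (clear; lia).
have := bridge ph v1D v2D nc.
have := pair_cross ph v1D v2D nc.
have : 1 + ~~ e v2 x2 <= #|D :&: S2|.
  apply: (pair_cross hp v2D v1D); rewrite setUC.
  by rewrite (sym_connect_sym (induced_sym _ e_sym)).
(clear; lia).
Qed.

End Small.

(** * Assembling the hamiltonian path *)

(** A graph with a vertex has a component, so deleting a cut vertex leaves at least two; one of them
    is the side. *)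
Lemma cut_vertex_sep (T : finType) (e : rel T) v : symmetric e -> cut_vertex e v -> cutv e v.
Proof.
move=> e_sym; rewrite /cut_vertex /components_in /n_comp_mem.
have sym1 S := sym_connect_sym (induced_sym S e_sym).
set r1 := roots _; set r2 := roots _ => lt.
have : 0 < #|[predI r1 & [set: T]]|.
  apply/card_gt0P; exists (root (induced e [set: T]) v).
  by rewrite !inE andbT; apply: roots_root.
move=> /leq_ltn_trans/(_ lt)/card_gt1P[x [y [/andP[xr]]]].
rewrite !inE => xv /andP[yr yv] xy.
apply/existsP; exists [set z | connect (induced e [set~ v]) x z].
have notv z : connect (induced e [set~ v]) x z -> z != v.
  case/connectP=> p; case/lastP: p => [|p w] /=; first by move=> _ ->.
  rewrite last_rcons rcons_path => /andP[_ /and3P[_ wv _]] ->.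
  by move: wv; rewrite !inE.
apply/and4P; split.
- by apply/set0Pn; exists x; rewrite inE connect0.
- by rewrite inE; apply/negP => /notv; rewrite eqxx.
- apply/eqP => /setP/(_ y); rewrite !inE (negPf yv) /= => xcy.
  case/eqP: xy; have /(rootP (sym1 _)) := xcy.
  by rewrite (eqP xr) (eqP yr).
apply/forall_inP => a; rewrite inE => xa; apply/forallP => b; apply/implyP => ab.
rewrite !inE; have [//|bv /=] := eqVneq b v.
by apply: (connect_stepI xa _ _ ab); rewrite !inE ?bv //; apply: notv.
Qed.

Lemma clique_walk (T : finType) (e : rel T) (N : {set T}) a s :
  {in N &, forall x y, x != y -> e x y} -> uniq (a :: s) -> {subset a :: s <= N} -> path e a s.
Proof.
move=> cN; elim: s a => //= b s IH a /andP[/norP[ab _] us] sub.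
have subs : {subset b :: s <= N} by move=> z zs; apply: sub; rewrite inE zs orbT.
by rewrite /= cN ?(sub a) ?(subs b) ?mem_head // IH.
Qed.

Section Traceable.

Variables (T : finType) (e : rel T) (k : nat) (C D : {set T}).
Hypotheses (e_sym : symmetric e) (e_irr : irreflexive e) (conn : connected_graph e).
Hypothesis kmin : forall S, connected_dominating e S -> k <= #|S|.
Hypothesis kadd : forall u w, u != w -> ~~ e u w ->
  exists2 S, connected_dominating (add_edge e u w) S & #|S| < k.
Hypothesis k4 : 4 <= k.
Hypotheses (cD : connected_dominating e D) (Dk : #|D| = k).
Hypotheses (C_cut : forall v, v \in C -> cutv e v) (Ck : k <= #|C| + 3).

Implicit Types (S N : {set T}) (u v w x y z : T).

(** * Counting the vertices of [D] in ends *)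

Definition nocut S := [forall x in S, ~~ cutv e x].

Lemma nocutP S : reflect {in S, forall x, ~~ cutv e x} (nocut S).
Proof. exact: forall_inP. Qed.

Lemma nocutU S1 S2 : nocut S1 -> nocut S2 -> nocut (S1 :|: S2).
Proof.
move=> /nocutP n1 /nocutP n2; apply/nocutP => x; rewrite inE.
by case/orP=> [/n1|/n2].
Qed.

Lemma cut_in_D v : cutv e v -> v \in D.
Proof. by case/existsP=> S; apply: cds_cut. Qed.

Lemma nocut_card S : nocut S -> #|D :&: S| <= 3.
Proof.
move=> /nocutP nS.
have CD : #|D :\: S| >= #|C|.
  apply: subset_leq_card; apply/subsetP => v /C_cut cv; rewrite inE cut_in_D // andbT.
  by apply: contraL cv => /nS.
by move: (cardsID S D) CD Ck Dk; clear; lia.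
Qed.

Lemma card_disj S1 S2 : (forall z, z \in S1 -> z \notin S2) ->
  #|D :&: (S1 :|: S2)| = #|D :&: S1| + #|D :&: S2|.
Proof.
move=> dis; rewrite setIUr cardsU; have -> : D :&: S1 :&: (D :&: S2) = set0; last by rewrite cards0 subn0.
by apply/setP => z; rewrite !inE; case: (boolP (z \in S1)) => [/dis/negPf->|]; rewrite ?andbF.
Qed.

(** A walk starting in [S'] outside [S] could leave [S'] only at [x], which lies in [S], and could
    enter [S] only from [v]. So it would find [v] in [S']. *)
Lemma sub_side v S x S' : sep e v S -> x \in S -> sep e x S' -> v \notin S' -> S' \subset S.
Proof.
move=> s xS s' vS'; have [_ vS _ cl] := sepP s; have [_ xS' _ cl'] := sepP s'.
apply/subsetP => t tS'; apply: contraT => tS.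
suff [] : v \in S' /\ v \notin S by rewrite (negPf vS').
apply: (@conn_total _ _ conn t v (fun z => z \in S' /\ z \notin S)) => // a b ab [aS' aS].
have aN c : c \in S -> ~~ e a c.
  move=> cS; apply/negP => ac; have := cl c a cS; rewrite e_sym !inE (negPf aS) orbF.
  by move=> /(_ ac)/eqP av; rewrite -av aS' in vS'.
have bS : b \notin S by apply: contraTN ab; apply: aN.
by split=> //; have := cl' _ _ aS' ab; rewrite !inE => /orP[/eqP bx|//]; rewrite bx xS in bS.
Qed.

Lemma other_side v x : cutv e x -> v != x -> exists2 S', sep e x S' & v \notin S'.
Proof.
case/existsP=> S' s' vx; have [vS'|vS'] := boolP (v \in S'); last by exists S'.
by exists (~: (x |: S')); [apply: sepC | rewrite !inE vS' orbT].
Qed.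

(** Descent: a cut vertex inside [S] has a side avoiding [v], and this is strictly smaller. *)
Lemma sub_end v S : sep e v S -> exists v' S', [/\ sep e v' S', S' \subset S & nocut S'].
Proof.
have [n] := ubnP #|S|; elim: n v S => // n IH v S Sn s.
have [nS|] := boolP (nocut S); first by exists v, S; rewrite subxx.
rewrite negb_forall => /existsP[x]; rewrite negb_imply negbK => /andP[xS cx].
have vx : v != x by have [_ vS _ _] := sepP s; apply: contraNneq vS => ->.
have [S' s' vS'] := other_side cx vx; have S'S := sub_side s xS s' vS'.
have [_ xS' _ _] := sepP s'.
have lt : #|S'| < n.
  rewrite -ltnS; apply: leq_ltn_trans Sn; apply: proper_card; rewrite properE S'S.
  by apply/subsetPn; exists x.
have [v2 [S2 [s2 S2S nS2]]] := IH x S' lt s'.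
by exists v2, S2; split=> //; apply: subset_trans S2S S'S.
Qed.

Lemma sep_cut v S : sep e v S -> cutv e v.
Proof. by move=> s; apply/existsP; exists S. Qed.

Lemma end_pair v1 S1 v2 S2 : sep e v1 S1 -> nocut S1 -> sep e v2 S2 -> nocut S2 ->
  (forall z, z \in S1 -> z \notin S2) -> #|D :&: S1| <= 1 -> 2 <= #|D :&: S2|.
Proof.
move=> s1 /nocutP n1 s2 /nocutP n2 dis; apply: (no_pair e_sym e_irr conn kmin kadd k4 s1 s2 dis).
- by apply/negP => /n2; rewrite (sep_cut s1).
- by apply/negP => /n1; rewrite (sep_cut s2).
- exact: cds_good.
- exact: cds_good.
Qed.

Lemma disj_sub S1 S2 S1' S2' : S1' \subset S1 -> S2' \subset S2 ->
  (forall z, z \in S1 -> z \notin S2) -> forall z, z \in S1' -> z \notin S2'.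
Proof.
move=> /subsetP s1 /subsetP s2 dis z /s1/dis; apply: contra; exact: s2.
Qed.

(** Each side contains an end. Two of the three ends would meet [D] twice, but their union contains
    no cut vertex and holds at most three vertices of [D]. *)
Lemma no_three v1 S1 v2 S2 v3 S3 : sep e v1 S1 -> sep e v2 S2 -> sep e v3 S3 ->
  (forall z, z \in S1 -> z \notin S2) -> (forall z, z \in S1 -> z \notin S3) ->
  (forall z, z \in S2 -> z \notin S3) -> False.
Proof.
move=> s1 s2 s3 d12 d13 d23.
have [u1 [E1 [e1 sub1 n1]]] := sub_end s1; have [u2 [E2 [e2 sub2 n2]]] := sub_end s2.
have [u3 [E3 [e3 sub3 n3]]] := sub_end s3.
have {}d12 := disj_sub sub1 sub2 d12; have {}d13 := disj_sub sub1 sub3 d13.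
have {}d23 := disj_sub sub2 sub3 d23.
have p12 := end_pair e1 n1 e2 n2 d12; have p13 := end_pair e1 n1 e3 n3 d13.
have p23 := end_pair e2 n2 e3 n3 d23.
have := nocut_card (nocutU n1 (nocutU n2 n3)).
rewrite card_disj ?card_disj //; first by move: p12 p13 p23; clear; lia.
by move=> z z1; rewrite inE negb_or d12 // d13.
Qed.

(** * The region between two cut vertices *)

Section Middle.

Variables (v x : T) (S S' : {set T}).
Hypotheses (s : sep e v S) (xS : x \in S) (s' : sep e x S') (vS' : v \notin S').

Let N := S :\: (x |: S').
Hypotheses (nN : nocut N) (DN : #|D :&: N| <= 1).

Let S'S : S' \subset S. Proof. exact: sub_side s xS s' vS'. Qed.
Let vS : v \notin S. Proof. by case/sepP: s. Qed.
Let xS' : x \notin S'. Proof. by case/sepP: s'. Qed.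
Let vx : v != x. Proof. by apply: contraNneq vS => ->. Qed.
Let cl a b : a \in S -> e a b -> b \in v |: S.
Proof. by case/sepP: s => _ _ _; apply. Qed.
Let cl' a b : a \in S' -> e a b -> b \in x |: S'.
Proof. by case/sepP: s' => _ _ _; apply. Qed.

Let NP z : (z \in N) = [&& z \in S, z != x & z \notin S'].
Proof. by rewrite !inE negb_or andbC. Qed.

Let SP z : (z \in S) = [|| z \in N, z == x | z \in S'].
Proof.
rewrite NP; have [->|_] /= := eqVneq z x; first by rewrite xS orbT.
by case: (boolP (z \in S')) => zS'; rewrite ?andbF ?andbT ?orbF // (subsetP S'S).
Qed.

Let NS z : z \in N -> z \in S. Proof. by rewrite NP => /and3P[]. Qed.

Lemma N_nbr a b : a \in N -> e a b -> [|| b \in N, b == v | b == x].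
Proof.
move=> aN ab; have := cl (NS aN) ab.
rewrite in_setU1 SP => /orP[->|/or3P[->|->|bS']]; rewrite ?orbT //.
have := @cl' b a bS'; rewrite e_sym => /(_ ab); rewrite in_setU1.
by move: aN; rewrite NP => /and3P[_ /negPf-> /negPf->].
Qed.

Lemma good_out u w S1 y D2 : sep e y S1 -> u \in S1 -> w \in S1 -> u != w ->
  connected_dominating (add_edge e u w) D2 -> good e y (~: (y |: S1)) (D2 :&: ~: (y |: S1)).
Proof.
move=> s1 uS wS uw cD2; have [uS' wS'] : u \in y |: S1 /\ w \in y |: S1 by rewrite !inE uS wS !orbT.
have a_sym := add_edge_sym u w e_sym.
apply: good_mono (cds_good a_sym cD2 (sepC a_sym (sep_add uS' wS' s1))).
have yS1 : y \notin S1 by case/sepP: s1.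
have out z : z \in S1 -> z \in y |: ~: (y |: S1) -> False.
  by move=> zS; rewrite !inE zS orbT orbF => /eqP zy; rewrite -zy zS in yS1.
by move=> a b aO bO /add_edgeP[//|[aE _]|[aE _]]; exfalso; apply: (out a) => //; rewrite aE.
Qed.

(* If [u] and [w] were not adjacent, then exchanging the traces on [N] of [D] and of a set [D2]
   witnessing criticality at [uw] shows that [D2] does not meet [N], hence never uses [uw]. *)
Lemma middle_clique : {in N &, forall u w, u != w -> e u w}.
Proof.
move=> u w uN wN uw; apply: contraT => nuw; have [D2 cD2 D2k] := kadd uw nuw.
have g1 : good e v (~: (v |: S)) (D2 :&: ~: (v |: S)) by apply: (good_out s (NS uN) (NS wN) uw cD2).
have S'E : ~: (x |: ~: (x |: S')) = S'.
  by apply/setP => z; rewrite !inE; case: eqP => [->|]; rewrite ?(negPf xS') //= negbK.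
have g2 : good e x S' (D2 :&: S').
  have := @good_out u w (~: (x |: S')) x D2 (sepC e_sym s').
  rewrite S'E; apply=> //; rewrite !inE; [move: uN | move: wN];
  by rewrite NP => /and3P[_ /negPf-> /negPf->].
have a_sym := add_edge_sym u w e_sym.
have vD2 : v \in D2.
  by apply: (cds_cut a_sym cD2 (sep_add _ _ s)); rewrite !inE NS ?orbT.
have xD2 : x \in D2.
  by apply: (cds_cut a_sym cD2 (sep_add _ _ (sepC e_sym s'))); rewrite !inE;
    [move: uN | move: wN]; rewrite NP => /and3P[_ /negPf-> /negPf->].
have [vD xD] : v \in D /\ x \in D by split; apply: cut_in_D; apply: sep_cut; eassumption.
have [_ cDS dDS] := cds_good e_sym cD s.
pose M := [set v; x] :|: (D :&: N).
have cM : connected_in e M.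
  have -> : M = (v |: (D :&: S)) :&: (x |: ~: (x |: S')).
    apply/setP => z; rewrite !inE; case: eqP => [->|] /=.
      by rewrite (negPf vS') orbF; case: (v == x).
    case: eqP => [->|] /=; first by rewrite xD xS.
    by case: (z \in S'); rewrite ?andbF //= andbT.
  apply: connected_in_retract; rewrite // ?in_setU1 ?inE ?xD ?xS ?orbT // => a b _ aS _ ab.
  by have [_ _ _ clc] := sepP (sepC e_sym s'); apply: clc ab.
case: g1 => _ c1 d1; case: g2 => _ c2 d2.
(* [D3] agrees with [D] on [N] and with [D2] elsewhere. *)
pose D3 := (v |: (D2 :&: ~: (v |: S))) :|: M :|: (x |: (D2 :&: S')).
have cD3 : connected_dominating e D3.
  apply/andP; split; last first.
    apply: (connected_inU (v := x)) => //; rewrite ?setU11 //; last first.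
      by rewrite !inE eqxx !orbT.
    by apply: (connected_inU (v := v)) => //; rewrite ?setU11 // !inE eqxx.
  apply/domP => z; rewrite 2!in_setU !negb_or => /andP[/andP[z1 zM] z2].
  move: z1 z2; rewrite !in_setU1 !negb_or => /andP[zv z1] /andP[zx z2].
  have [zS|zS] := boolP (z \in S); last first.
    have [||y yX zy] := d1 z; rewrite ?inE ?negb_or ?zv // in z1 *.
    by exists y; rewrite // 2!in_setU yX.
  move: (zS); rewrite SP (negPf zx) /= => /orP[zN|zS']; last first.
    by have [y yX zy] := d2 z zS' z2; exists y; rewrite // in_setU yX orbT.
  have zD : z \notin D by apply: contra zM => zD; rewrite in_setU in_setI zD zN orbT.
  have [|y yD zy] := dDS z zS; first by rewrite inE (negPf zD).
  exists y => //; suff yM : y \in M by rewrite 2!in_setU yM orbT.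
  have /or3P[yN|/eqP->|/eqP->] := N_nbr zN zy; rewrite in_setU in_set2 ?eqxx ?orbT //.
  move: yD; rewrite in_setU1 !in_setI yN andbT => /orP[->//|/andP[-> _]].
  by rewrite orbT.
have lt : #|D2 :&: N| < #|D :&: N|.
  have : #|D3| <= #|D2 :\: N| + #|D :&: N|.
    apply: leq_trans (leq_card_setU _ _).1; apply: subset_leq_card.
    have vN : v \notin N by rewrite NP (negPf vS).
    have xN : x \notin N by rewrite NP eqxx andbF.
    apply/subsetP => z zD3; rewrite in_setU in_setD in_setI.
    case/setUP: zD3 => [/setUP[|]|].
    - case/setU1P=> [->|]; first by rewrite vN vD2.
      rewrite in_setI in_setC in_setU1 negb_or NP => /and3P[-> _ /negPf->] //.
    - case/setUP=> [/set2P[]->|]; first by rewrite vN vD2.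
        by rewrite xN xD2.
      by rewrite in_setI => ->; rewrite orbT.
    - case/setU1P=> [->|]; first by rewrite xN xD2.
      by rewrite in_setI NP => /andP[-> ->]; rewrite !andbF.
  by move: (kmin cD3) D2k (cardsID N D2); clear; lia.
have D0 : D2 :&: N = set0 by apply: cards0_eq; move: lt DN; clear; lia.
have nD z : z \in N -> z \notin D2.
  by move=> zN; apply/negP => zD; have := in_set0 z; rewrite -D0 inE zD zN.
by have := kmin (add_cds cD2 (nD _ uN) (nD _ wN)); rewrite leqNgt D2k.
Qed.

Lemma nbr_in y S1 : sep e y S1 -> exists2 t, t \in S1 & e y t.
Proof.
move=> s1; have [[t tS] yS _ clS] := sepP s1.
case: (boolP [exists t in S1, e y t]) => [/exists_inP//|/exists_inP no].
suff : t \notin S1 by rewrite tS.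
apply: (@conn_total _ _ conn y t (fun z => z \notin S1)) => // a b ab aS.
apply/negP => bS; have := clS b a bS; rewrite e_sym !inE (negPf aS) orbF => /(_ ab)/eqP ay.
by case: no; exists b; rewrite // -ay.
Qed.

(** Otherwise both [N] and [N :|: S'] are sides of [x]. Then [x] has a neighbour in [N] and one in
    [S'], and [sep_clique] makes these adjacent although no edge joins the two sets. *)
Lemma middle_left : N != set0 -> exists2 n, n \in N & e v n.
Proof.
case/set0Pn=> n0 n0N.
case: (boolP [exists n in N, e v n]) => [/exists_inP//|/exists_inP no]; exfalso.
have nv a : a \in N -> ~~ e a v.
  by move=> aN; rewrite e_sym; apply/negP => va; apply: no; exists a.
have sx : sep e x (N :|: S').
  apply/and4P; split.
  - by apply/set0Pn; exists n0; rewrite inE n0N.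
  - by rewrite in_setU NP eqxx andbF.
  - by apply/eqP => /setP/(_ v); rewrite in_setU1 in_setU NP (negPf vx) (negPf vS) (negPf vS') inE.
  apply/forall_inP => a; rewrite in_setU => aX; apply/forallP => b; apply/implyP => ab.
  rewrite in_setU1 in_setU; case/orP: aX => [aN|aS'].
    have /or3P[->|/eqP bv|->] := N_nbr aN ab; rewrite ?orbT //.
    by have := nv _ aN; rewrite -bv ab.
  by have := cl' aS' ab; rewrite in_setU1 => /orP[->|->]; rewrite ?orbT.
have sn : sep e x N.
  apply/and4P; split.
  - by apply/set0Pn; exists n0.
  - by rewrite NP eqxx andbF.
  - by apply/eqP => /setP/(_ v); rewrite in_setU1 NP (negPf vx) (negPf vS) inE.
  apply/forall_inP => a aN; apply/forallP => b; apply/implyP => ab; rewrite in_setU1.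
  have /or3P[->|/eqP bv|->] := N_nbr aN ab; rewrite ?orbT //.
  by have := nv _ aN; rewrite -bv ab.
have [m mN xm] := nbr_in sn; have [t tS' xt] := nbr_in s'.
have mS' : m \notin S' by move: mN; rewrite NP => /and3P[].
have mt : m != t by apply: contraNneq mS' => ->.
have := sep_clique e_sym kmin kadd sx _ _ xm xt mt; rewrite !in_setU mN tS' orbT.
move=> /(_ isT isT); rewrite e_sym => /(cl' tS'); rewrite in_setU1 (negPf mS') orbF.
by move: mN; rewrite NP => /and3P[_ /negPf->].
Qed.

(** The mirror image at [v]: [N] and the far side of [v] would together form a side of [v], with
    neighbours of [v] in both parts. *)
Lemma middle_right : N != set0 -> exists2 n, n \in N & e n x.
Proof.
move=> N0; case/set0Pn: (N0) => n0 n0N.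
case: (boolP [exists n in N, e n x]) => [/exists_inP//|/exists_inP no]; exfalso.
have nx a : a \in N -> ~~ e a x by move=> aN; apply/negP => ax; apply: no; exists a.
have sO := sepC e_sym s; set O := ~: (v |: S) in sO.
have OP z : (z \in O) = (z != v) && (z \notin S) by rewrite !inE negb_or.
have sv : sep e v (N :|: O).
  apply/and4P; split.
  - by apply/set0Pn; exists n0; rewrite inE n0N.
  - by rewrite in_setU NP OP (negPf vS) eqxx.
  - apply/eqP => /setP/(_ x); rewrite in_setU1 in_setU NP OP [x == v]eq_sym (negPf vx) xS eqxx.
    by rewrite inE !andbF.
  apply/forall_inP => a; rewrite in_setU => aX; apply/forallP => b; apply/implyP => ab.
  rewrite in_setU1 in_setU; case/orP: aX => [aN|aO].
    have /or3P[->|->|/eqP bx] := N_nbr aN ab; rewrite ?orbT //.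
    by have := nx _ aN; rewrite -bx ab.
  have [_ _ _ clO] := sepP sO.
  by have := clO _ _ aO ab; rewrite in_setU1 => /orP[->|->]; rewrite ?orbT.
have [n nIn vn] := middle_left N0; have [t tO vt] := nbr_in sO.
have nt : n != t by apply: contraTneq tO => <-; rewrite OP (NS nIn) andbF.
have := sep_clique e_sym kmin kadd sv _ _ vn vt nt; rewrite !in_setU nIn tO orbT.
move=> /(_ isT isT) /(cl (NS nIn)); rewrite in_setU1.
by move: tO; rewrite OP => /andP[/negPf-> /negPf->].
Qed.

(** The clique [N] is crossed from a neighbour of [v] to a different neighbour of [x]. If a single
    vertex were the only choice for both while [N] has others, it would separate these from the
    graph, contrary to [nN]. *)
Lemma middle_path : exists p, [/\ path e v p, last v p = x, uniq p & p =i x |: N].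
Proof.
have xN : x \notin N by rewrite NP eqxx andbF.
have ends n m : n \in N -> m \in N -> e v n -> e m x -> (n != m) || (#|N| == 1) ->
    exists p, [/\ path e v p, last v p = x, uniq p & p =i x |: N].
  move=> nIn mN vn mx nm; have [nmE|nm'] := eqVneq n m.
    move: nm; rewrite nmE eqxx /= => /cards1P[a NE].
    have mE : m = a by move: mN; rewrite NE => /set1P.
    exists [:: m; x]; split=> /=.
    - by rewrite -nmE vn nmE mx.
    - by [].
    - by rewrite inE andbT; apply: contraNneq xN => <-.
    - by move=> z; rewrite NE !inE mE orbC.
  pose s1 := enum (N :\ n :\ m).
  have s1P z : (z \in s1) = [&& z != m, z != n & z \in N] by rewrite mem_enum !inE.
  exists (n :: s1 ++ [:: m; x]); split=> /=.
  - have : path e n (rcons s1 m).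
      apply: (clique_walk middle_clique).
        rewrite /= mem_rcons inE negb_or nm' s1P eqxx andbF /= rcons_uniq s1P eqxx /=.
        exact: enum_uniq.
      by move=> z; rewrite inE mem_rcons inE => /or3P[/eqP->|/eqP->|] //; rewrite s1P => /and3P[].
    by rewrite rcons_path cat_path vn => /andP[-> /= ->]; rewrite mx.
  - by rewrite last_cat.
  - rewrite mem_cat s1P eqxx andbF /= !inE (negPf nm') /= cat_uniq enum_uniq /=.
    rewrite !s1P eqxx (negPf xN) !andbF /= !inE andbT.
    by apply/andP; split; [apply: contraNneq xN => <- | apply: contraNneq xN => <-].
  - move=> z; rewrite in_cons mem_cat s1P !in_cons in_nil orbF in_setU1.
    have [->|zn] /= := eqVneq z n; first by rewrite nIn orbT.
    have [->|zm] /= := eqVneq z m; first by rewrite mN orbT.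
    by rewrite orbC.
have [N0|N0] := eqVneq N set0.
  have [n nS vn] := nbr_in s; move: (nS); rewrite SP N0 inE /= => /orP[/eqP nx|nS'].
    exists [:: x]; split=> //=; first by rewrite -nx vn.
    by move=> z; rewrite setU0 !inE.
  have := @cl' n v nS'; rewrite e_sym => /(_ vn); rewrite !inE (negPf vx) (negPf vS').
  by [].
have [n nIn vn] := middle_left N0; have [m mN mx] := middle_right N0.
have [nm|nm] := boolP ((n != m) || (#|N| == 1)); first exact: (ends n m).
move: nm; rewrite negb_or negbK => /andP[/eqP nmE N1]; rewrite -{m}nmE in mN mx.
case: (boolP [exists a in N, (a != n) && e v a]) => [/exists_inP[a aN /andP[an va]]|no1].
  by apply: (ends a n); rewrite ?an.
case: (boolP [exists a in N, (a != n) && e a x]) => [/exists_inP[a aN /andP[an ax]]|no2].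
  by apply: (ends n a); rewrite // eq_sym an.
have nE a : a \in N -> a != n -> ~~ e a v /\ ~~ e a x.
  move=> aN an; split; apply/negP => h.
    by case/negP: no1; apply/exists_inP; exists a; rewrite // an e_sym.
  by case/negP: no2; apply/exists_inP; exists a; rewrite // an.
exfalso; have /nocutP/(_ n nIn)/negP := nN; apply; apply: (@sep_cut _ (N :\ n)).
apply/and4P; split.
- apply: contraNneq N1 => N1; apply/cards1P; exists n.
  apply/setP => z; rewrite in_set1; have [->//|zn] := eqVneq z n.
  by apply/negP => zN; have := in_set0 z; rewrite -N1 in_setD1 zn zN.
- by rewrite !in_setD1 eqxx.
- apply/eqP => /setP/(_ v); rewrite in_setU1 in_setD1 NP (negPf vS) in_setT andbF orbF => /eqP vn'.
  by have := NS nIn; rewrite -vn' (negPf vS).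
apply/forall_inP => a; rewrite in_setD1 => /andP[an aN]; apply/forallP => b; apply/implyP => ab.
have [av ax] := nE a aN an; rewrite in_setU1 in_setD1; have [//|bn] /= := eqVneq b n.
have /or3P[//|/eqP bv|/eqP bx] := N_nbr aN ab; first by rewrite -bv ab in av.
by rewrite -bx ab in ax.
Qed.

End Middle.

Lemma end_hamilton v S : sep e v S -> nocut S -> exists p, [/\ path e v p, uniq p & p =i S].
Proof.
move=> s nS; have g := cds_good e_sym cD s.
have [p [pp pE]] := end_path e_sym e_irr conn kmin kadd s (nocutP _ nS) g (nocut_card nS).
exists p; split=> //; first by rewrite (perm_uniq pE) enum_uniq.
by move=> z; rewrite (perm_mem pE) mem_enum.
Qed.

(** * Induction along the chain of cut vertices *)

Section FromEnd.

Variables (v1 : T) (S1 : {set T}).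
Hypotheses (s1 : sep e v1 S1) (n1 : nocut S1).

(** [S'] is a largest side avoiding [v] of a cut vertex [x] in [S]. A cut vertex between [v] and [x]
    would have a side that contains [S'] and [x], against this choice, or is disjoint from [S1] and
    [S'], against [no_three]. *)
Lemma side_hamilton v S : sep e v S -> (forall z, z \in S1 -> z \notin S) ->
  exists p, [/\ path e v p, uniq p & p =i S].
Proof.
have [n] := ubnP #|S|; elim: n v S => // n IH v S Sn s d1.
have [nS|] := boolP (nocut S); first exact: end_hamilton.
rewrite negb_forall => /existsP[x0]; rewrite negb_imply negbK => /andP[x0S cx0].
have vS : v \notin S by case/sepP: s.
have vx0 : v != x0 by apply: contraNneq vS => ->.
have [S0 s0 vS0] := other_side cx0 vx0.
pose inner (q : T * {set T}) := [&& q.1 \in S, sep e q.1 q.2 & v \notin q.2].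
have inner0 : inner (x0, S0) by rewrite /inner /= x0S s0.
case: (@arg_maxnP _ (x0, S0) inner (fun q => #|q.2|) inner0) => -[x S'] /and3P[/= xS s' vS'] max.
have S'S := sub_side s xS s' vS'.
have xS' : x \notin S' by case/sepP: s'.
have d1' z : z \in S1 -> z \notin S' by move=> /d1; apply: contra; apply: (subsetP S'S).
pose N := S :\: (x |: S').
have nN : nocut N.
  apply/nocutP => y; rewrite in_setD in_setU1 negb_or => /andP[/andP[yx yS'] yS].
  apply/negP => cy; have vy : v != y by apply: contraNneq vS => ->.
  have [S2 s2 vS2] := other_side cy vy; have S2S := sub_side s yS s2 vS2.
  have [xS2|xS2] := boolP (x \in S2).
    have sub := sub_side s2 xS2 s' yS'.
    have := max (y, S2); rewrite /inner /= yS s2 vS2 => /(_ isT).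
    rewrite leqNgt => /negP; apply; apply: proper_card; rewrite properE sub.
    by apply/subsetPn; exists x.
  have [_ _ _ cl'] := sepP s'; have [_ _ _ cl2] := sepP s2.
  apply: (no_three s1 s' s2 d1') => z; first by move=> /d1; apply: contra; apply: (subsetP S2S).
  move=> zS'; apply/negP => zS2; suff [] : v \in S' /\ v \in S2 by rewrite (negPf vS').
  apply: (@conn_total _ _ conn z v (fun z => z \in S' /\ z \in S2)) => // a b ab [aS' aS2].
  have := cl' _ _ aS' ab; have := cl2 _ _ aS2 ab; rewrite !in_setU1.
  case/predU1P=> [->|b2]; first by rewrite (negPf yx) (negPf yS').
  by case/predU1P=> [bx|//]; rewrite -bx b2 in xS2.
have [x2 [S2 [s2 S2S' n2]]] := sub_end s'.
have d12 z : z \in S1 -> z \notin S2 by move=> /d1'; apply: contra; apply: (subsetP S2S').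
have h12 := end_pair s1 n1 s2 n2 d12.
(* [S1], [S2] and [N] together hold at most three vertices of [D], and the two ends take at least
   two of them. *)
have DN : #|D :&: N| <= 1.
  have := nocut_card (nocutU n1 (nocutU n2 nN)); rewrite card_disj ?card_disj; last first.
  - by move=> z /d1 zS; rewrite in_setU in_setD (negPf zS) andbF orbF; apply: contra zS => /(subsetP S2S')/(subsetP S'S).
  - by move=> z /(subsetP S2S') zS'; rewrite in_setD in_setU1 zS' orbT.
  by move: h12; clear; lia.
have [p [pp px up pN]] := middle_path s xS s' vS' nN DN.
have lt : #|S'| < n.
  rewrite -ltnS; apply: leq_ltn_trans Sn; apply: proper_card; rewrite properE S'S.
  by apply/subsetPn; exists x.
have [q [pq uq qS']] := IH x S' lt s' d1'.
exists (p ++ q); split.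
- by rewrite cat_path pp px.
- rewrite cat_uniq up uq andbT /=; apply/hasPn => z; rewrite qS' => zS'.
  rewrite pN in_setU1 in_setD in_setU1 zS' orbT orbF.
  by apply: contraNneq xS' => <-.
move=> z; rewrite mem_cat pN qS' in_setU1 in_setD in_setU1.
have [->|_] /= := eqVneq z x; first by rewrite xS.
by case: (boolP (z \in S')) => zS'; rewrite ?orbF // (subsetP S'S).
Qed.

End FromEnd.

Lemma traceable_of_cut v : cutv e v -> traceable e.
Proof.
case/existsP=> S /sub_end[v1 [S1 [s1 _ n1]]].
have sC := sepC e_sym s1.
have [p [pp up pS]] := end_hamilton s1 n1.
have [|q [pq uq qS]] := side_hamilton s1 n1 sC.
  by move=> z zS; rewrite !inE zS orbT.
have v1S1 : v1 \notin S1 by case/sepP: s1.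
exists (rev p ++ v1 :: q); split.
- have : sorted e (rev (v1 :: p)) by rewrite sorted_rev_sym.
  rewrite rev_cons; case: (rev p) => [|b r] //=.
  by rewrite rcons_path cat_path /= pq => /andP[-> ->].
- rewrite cat_uniq rev_uniq up /= uq qS !inE eqxx /= andbT negb_or mem_rev pS v1S1 /=.
  apply/hasPn => z; rewrite qS mem_rev pS !inE negb_or => /andP[_].
  by [].
move=> z; rewrite mem_cat mem_rev inE pS qS !inE.
by case: (z == v1); case: (z \in S1).
Qed.

End Traceable.

Theorem theorem4p4 (T : finType) (e : rel T) (k zeta : nat)
  (e_sym : symmetric e) (e_irrefl : irreflexive e)
  (k_ge4 : 4 <= k) (zetaE : zeta = k - 3 \/ zeta = k - 2)
  (crit : gamma_c_critical k e)
  (cutE : #|[set v : T | cut_vertex e v]| = zeta) :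
  traceable e.
Proof.
have [conn gk critical] := crit.
have [[D cD Dk] kmin] := gamma_cP conn; rewrite gk in Dk kmin.
have kadd u w : u != w -> ~~ e u w ->
    exists2 S, connected_dominating (add_edge e u w) S & #|S| < k.
  move=> uw nuw; have conn' : connected_graph (add_edge e u w).
    by apply: connected_in_mono conn => x y _ _; apply: add_edge_old.
  have [[S cS Sk] _] := gamma_cP conn'; exists S => //.
  by rewrite Sk; apply: critical.
set C := [set v | cut_vertex e v] in cutE.
have C_cut v : v \in C -> cutv e v by rewrite inE; apply: cut_vertex_sep.
have [v vC] : exists v, v \in C.
  by apply/card_gt0P; rewrite cutE; case: zetaE => ->; rewrite subn_gt0 (leq_trans _ k_ge4).
apply: (traceable_of_cut e_sym e_irrefl conn kmin kadd k_ge4 cD Dk C_cut _ (C_cut _ vC)).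
by rewrite cutE; move: zetaE; clear; lia.
Qed.
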